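(* Let $S$ be the curve $(y+x^2)(y-x^2)=0$ (the tangency point of two conics at the origin). Its local braid monodromy $\beta$ at $(0,0)$ is two counterclockwise full-twists of the two points $y=1$ and $y=-1$ of the fiber over $x=1$, i.e. the braid induced by the motion which rotates these two points about $0$ by the angle $4\pi$ counterclockwise. The induced relations are $$(x_1x_2)^2=(x_2x_1)^2,$$ where $\{x_1,x_2\}$ are the generators of the standard g-base.
   Context: Let $E=\{x\in\mathbb{C}:|x|\le 1\}$, $D=\{y\in\mathbb{C}:|y|\le 4\}$, and regard $S$ as a curve in $E\times D$. The projection of $S$ to $E$ has fibers of constant cardinality $n$ ($n=2$ here) except over $x=0$. Let $K\subset D$ be the set of $y$-coordinates of the points of $S$ over $x=1$. A motion of $K$ in $D$ consists of $n$ continuous functions $m_i:[0,1]\to D$ with $m_i(t)\ne m_j(t)$ for all $t$ and $i\neq j$, and $\{m_i(0)\}=\{m_i(1)\}=K$. It is realized by a continuous family of diffeomorphisms $D_t$ of $D$, $D_0=\mathrm{Id}$, equal to the identity on $\partial D$, with $D_t(m_i(0))=m_i(t)$; the braid induced by the motion is the class of $D_1$ in the braid group $B_n[D,K]$, the group of diffeomorphisms of $D$ preserving $K$ and equal to the identity on $\partial D$, two being identified if they induce the same automorphism of $\pi_1(D-K,u_0)$. The local braid monodromy $\beta$ of $S$ at $(0,0)$ is the braid induced by the motion formed by the points of $S$ over $x=e^{2\pi i t}$, $0\le t\le 1$. Standard g-base: take the base point $u_0=-4i$ and let $p_1<\dots<p_n$ be the (real) points of $K$. The loop $x_i$ goes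 from $u_0$ along the straight segment to near $p_i$, once counterclockwise around $p_i$ on a small circle, and back. In a product of loops the left factor is traversed first. The group $\pi_1(D-K,u_0)$ is free on $x_1,\dots,x_n$. The relations induced by $\beta$ are $\beta(x_j)=x_j$, $j=1,\dots,n$. Saying that ''the induced relations are $R$'' means that $R$ and $\{\beta(x_j)=x_j\}_j$ have the same normal closure in the free group on $x_1,\dots,x_n$. *)

(* Defs.v *)
From HB Require Import structures.
From mathcomp Require Import all_boot all_order all_algebra complex.
From mathcomp Require Import boolp classical_sets functions reals.
From mathcomp Require Import topology normedtype derive trigo.
From mathcomp Require Import lra.

Set Implicit Arguments.
Unset Strict Implicit.
Unset Printing Implicit Defensive.

Import Order.TTheory GRing.Theory Num.Theory numFieldNormedType.Exports.

Local Open Scope classical_set_scope.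
Local Open Scope ring_scope.
Local Open Scope complex_scope.
Local Open Scope quotient_scope.

Lemma within_continuous_comp (S T U : topologicalType) (A : set S) (B : set T)
    (f : S -> T) (g : T -> U) :
  {within A, continuous f} -> {within B, continuous g} ->
  (forall x, A x -> B (f x)) -> {within A, continuous (g \o f)}.
Proof.
move=> /subspace_continuousP cf /subspace_continuousP cg AB.
apply/subspace_continuousP => x Ax.
apply: cvg_trans (cg _ (AB _ Ax)) => W /= W1.
have := cf x Ax _ W1; rewrite /= !nbhs_simpl /= /within /=.
apply: filterS => y Wy Ay; apply: Wy => //; exact: AB.
Qed.

Lemma within_continuousE (S T : topologicalType) (A : set S) (f g : S -> T) :
  (forall x, A x -> f x = g x) ->
  {within A, continuous f} -> {within A, continuous g}.
Proof.
move=> fg; apply: subspace_eq_continuous => x; rewrite inE => Ax.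
exact: fg.
Qed.

Lemma continuous_pair (S T U : topologicalType) (f : S -> T) (g : S -> U) :
  continuous f -> continuous g -> continuous (fun x => (f x, g x)).
Proof.
by move=> cf cg x; apply: (@cvg_pair _ _ _ (nbhs x) (nbhs (f x)) (nbhs (g x)));
  [exact: cf|exact: cg].
Qed.

Lemma continuous_fst (S T : topologicalType) : continuous (@fst S T).
Proof. by move=> x; exact: cvg_fst. Qed.

Lemma continuous_snd (S T : topologicalType) : continuous (@snd S T).
Proof. by move=> x; exact: cvg_snd. Qed.

Lemma continuous_comp2 (S T U : topologicalType) (f : S -> T) (g : T -> U) :
  continuous f -> continuous g -> continuous (fun x => g (f x)).
Proof. by move=> cf cg x; apply: continuous_comp; [exact: cf|exact: cg]. Qed.

Section Interval.
Context {R : realType}.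
Implicit Types (s t : R).

Definition I01 : set R := `[0, 1]%classic.

Lemma I01P t : I01 t <-> 0 <= t <= 1.
Proof. by rewrite /I01 /= in_itv. Qed.

Lemma I01_0 : I01 0. Proof. by apply/I01P; rewrite lexx ler01. Qed.
Lemma I01_1 : I01 1. Proof. by apply/I01P; rewrite lexx ler01. Qed.

Definition clamp (t : R) : R := Num.min 1 (Num.max 0 t).

Lemma clamp_in t : I01 (clamp t).
Proof.
by apply/I01P; rewrite /clamp le_min ler01 le_max lexx ge_min lexx.
Qed.

Lemma clamp_id t : I01 t -> clamp t = t.
Proof. by move=> /I01P/andP[t0 t1]; rewrite /clamp max_r// min_r. Qed.

Lemma continuous_clamp : continuous clamp.
Proof.
move=> t; apply: continuous_min; first exact: cvg_cst.
by apply: continuous_max; [exact: cvg_cst|exact: cvg_id].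
Qed.

Lemma continuous_glue (S T : topologicalType) (u : S -> R) (c : R)
    (a b : S -> T) :
  continuous u -> continuous a -> continuous b ->
  (forall x, u x = c -> a x = b x) ->
  continuous (fun x => if u x <= c then a x else b x).
Proof.
move=> cu ca cb ab.
set h := fun x => _.
have cl1 : closed [set x | u x <= c].
  by have /continuous_closedP/(_ _ (@closed_le _ c)) := cu.
have cl2 : closed [set x | c <= u x].
  by have /continuous_closedP/(_ _ (@closed_ge _ c)) := cu.
have h1 : {within [set x | u x <= c], continuous h}.
  apply: (within_continuousE (f := a)); last exact: continuous_subspaceT.
  by move=> x /= uxc; rewrite /h uxc.
have h2 : {within [set x | c <= u x], continuous h}.
  apply: (within_continuousE (f := b)); last exact: continuous_subspaceT.
  move=> x /= cux; rewrite /h; case: ifPn => // uxc.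
  by rewrite ab//; apply/eqP; rewrite eq_le uxc cux.
have := withinU_continuous cl1 cl2 h1 h2.
have -> : [set x | u x <= c] `|` [set x | c <= u x] = setT.
  by rewrite eqEsubset; split=> x _ //=; apply/orP; exact: le_total.
by move=> ch; apply/continuous_subspace_setT.
Qed.

Lemma I01_rev (t : R) : I01 t -> I01 (1 - t).
Proof.
by move=> /I01P/andP[s0 s1]; apply/I01P; rewrite subr_ge0 s1 lerBlDr lerDl.
Qed.

Lemma continuous_rev : continuous (fun t : R => 1 - t).
Proof. by move=> t; apply: cvgB; [exact: cvg_cst|exact: cvg_id]. Qed.

Lemma half2 : 2 * (2^-1) = 1 :> R.
Proof. by lra. Qed.

Lemma I01_half1 t : I01 t -> t <= 2^-1 -> I01 (2 * t).
Proof. by move=> /I01P t01 th; apply/I01P; have := half2; lra. Qed.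

Lemma I01_half2 t : I01 t -> (t <= 2^-1) = false -> I01 (2 * t - 1).
Proof.
move=> /I01P t01 /negbT; rewrite -ltNge => th; apply/I01P.
by have := half2; lra.
Qed.

Lemma half_le1 : (1 <= 2^-1 :> R) = false.
Proof. by apply/negbTE; rewrite -ltNge; have := half2; lra. Qed.

Lemma two_sub1 : 2 * 1 - 1 = 1 :> R.
Proof. by lra. Qed.

Lemma continuous_dbl : continuous (fun t : R => 2 * t).
Proof. by move=> t; apply: cvgM; [exact: cvg_cst|exact: cvg_id]. Qed.

Lemma continuous_dblB1 : continuous (fun t : R => 2 * t - 1).
Proof. by move=> t; apply: cvgB; [exact: continuous_dbl|exact: cvg_cst]. Qed.

End Interval.

Arguments I01 {R}.

Record pset (T : Type) := PSet {
  pset_car :> set T;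
  pset_pt : T;
  pset_ptP : pset_car pset_pt }.

Section Loop.
Context {R : realType} {T : topologicalType} (X : pset T).

Record loop := Loop {
  loop_fun :> R -> T;
  loop_cts : {within I01, continuous loop_fun};
  loop_in : forall t, I01 t -> pset_car X (loop_fun t);
  loop_0 : loop_fun 0 = pset_pt X;
  loop_1 : loop_fun 1 = pset_pt X }.

HB.instance Definition _ := gen_eqMixin loop.
HB.instance Definition _ := gen_choiceMixin loop.

(* In H (s, t), s is the parameter of the deformation, t that of the loop. *)
Definition homotopic (f g : loop) : Prop :=
  exists H : R * R -> T,
    [/\ {within I01 `*` I01, continuous H},
        (forall s t, I01 s -> I01 t -> pset_car X (H (s, t))),
        (forall t, I01 t -> H (0, t) = f t),
        (forall t, I01 t -> H (1, t) = g t)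
      & (forall s, I01 s -> H (s, 0) = pset_pt X /\ H (s, 1) = pset_pt X)].

Definition homotopicb (f g : loop) : bool := `[< homotopic f g >].

Lemma loop_ext (f : loop) : continuous (f \o clamp).
Proof.
apply/continuous_subspace_setT.
apply: within_continuous_comp (@loop_cts f) _ => [|t _]; last exact: clamp_in.
by apply: continuous_subspaceT; exact: continuous_clamp.
Qed.

Lemma homotopy_ext (H : R * R -> T) : {within I01 `*` I01, continuous H} ->
  continuous (fun p : R * R => H (clamp p.1, clamp p.2)).
Proof.
move=> cH; apply/continuous_subspace_setT.
apply: (@within_continuous_comp _ _ _ _ _
  (fun p : R * R => (clamp p.1, clamp p.2)) H _ cH) => [|p _]; last first.
  by split; exact: clamp_in.
apply: continuous_subspaceT; apply: continuous_pair.
- exact: continuous_comp2 (@continuous_fst _ _) (@continuous_clamp _).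
- exact: continuous_comp2 (@continuous_snd _ _) (@continuous_clamp _).
Qed.

Lemma homotopic_reparam (l f g : loop) (p q : R -> R) :
  continuous p -> continuous q ->
  (forall t, I01 t -> I01 (p t)) -> (forall t, I01 t -> I01 (q t)) ->
  p 0 = q 0 -> p 1 = q 1 ->
  (forall t, I01 t -> f t = l (p t)) ->
  (forall t, I01 t -> g t = l (q t)) ->
  homotopic f g.
Proof.
move=> cp cq pI qI pq0 pq1 fl gl.
pose u (z : R * R) := (1 - z.1) * p z.2 + z.1 * q z.2.
have cu : continuous u.
  move=> z; apply: cvgD; apply: cvgM.
  - by apply: cvgB; [exact: cvg_cst|exact: cvg_fst].
  - exact: (continuous_comp2 (@continuous_snd _ _) cp).
  - exact: cvg_fst.
  - exact: (continuous_comp2 (@continuous_snd _ _) cq).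
have uI s t : I01 s -> I01 t -> I01 (u (s, t)).
  move=> /I01P/andP[s0 s1] It; rewrite /u /=.
  have /I01P/andP[p0 p1] := pI _ It; have /I01P/andP[q0 q1] := qI _ It.
  apply/I01P; apply/andP; split.
    by rewrite addr_ge0// mulr_ge0// subr_ge0.
  rewrite -[leRHS](subrK s) lerD//.
    by rewrite -[leRHS]mulr1 ler_wpM2l// subr_ge0.
  by rewrite -[leRHS]mulr1 ler_wpM2l.
exists (l \o clamp \o u); split.
- apply: continuous_subspaceT => z; apply: continuous_comp; first exact: cu.
  exact: loop_ext.
- by move=> s t Is It /=; apply: loop_in; exact: clamp_in.
- move=> t It /=; rewrite clamp_id; last by apply: uI => //; exact: I01_0.
  by rewrite /u /= subr0 mul1r mul0r addr0 fl.
- move=> t It /=; rewrite clamp_id; last by apply: uI => //; exact: I01_1.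
  by rewrite /u /= subrr mul1r mul0r add0r gl.
- move=> s Is /=; rewrite !clamp_id; last 2 first.
    by apply: uI => //; exact: I01_1.
    by apply: uI => //; exact: I01_0.
  rewrite /u /= pq0 pq1 -!mulrDl !subrK !mul1r.
  rewrite -(gl _ I01_0) -(gl _ I01_1).
  by rewrite loop_0 loop_1.
Qed.

Lemma homotopic_eq (f g : loop) :
  (forall t, I01 t -> f t = g t) -> homotopic f g.
Proof.
move=> fg; apply: (@homotopic_reparam g f g id id) => // t; exact: cvg_id.
Qed.

Lemma homotopicb_refl : reflexive homotopicb.
Proof. by move=> f; apply/asboolP; exact: homotopic_eq. Qed.

Lemma homotopic_sym f g : homotopic f g -> homotopic g f.
Proof.
case=> H [cH HX H0 H1 He].
exists (fun z => H (1 - z.1, z.2)); split.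
- apply: (@within_continuous_comp _ _ _ _ _
    (fun z : R * R => (1 - z.1, z.2)) H _ cH).
    apply: continuous_subspaceT; apply: continuous_pair;
      last exact: continuous_snd.
    exact: (continuous_comp2 (@continuous_fst _ _) continuous_rev).
  by move=> z /= [z1 z2]; split=> //=; exact: I01_rev.
- by move=> s t Is It; apply: HX => //; exact: I01_rev.
- by move=> t It /=; rewrite subr0 H1.
- by move=> t It /=; rewrite subrr H0.
- by move=> s Is /=; apply: He; exact: I01_rev.
Qed.

Lemma homotopicb_sym : symmetric homotopicb.
Proof.
by move=> f g; apply/idP/idP => /asboolP ?; apply/asboolP; exact: homotopic_sym.
Qed.

Lemma homotopic_trans f g h :
  homotopic f g -> homotopic g h -> homotopic f h.
Proof.
case=> H [cH HX H0 H1 He] [K [cK KX K0 K1 Ke]].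
pose H' (z : R * R) := H (clamp z.1, clamp z.2).
pose K' (z : R * R) := K (clamp z.1, clamp z.2).
have cH' : continuous H' := homotopy_ext cH.
have cK' : continuous K' := homotopy_ext cK.
exists (fun z => if z.1 <= 2^-1 then H' (2 * z.1, z.2)
                 else K' (2 * z.1 - 1, z.2)).
split.
- apply: continuous_subspaceT.
  apply: (@continuous_glue _ _ _ (fun z : R * R => z.1) 2^-1
    (fun z => H' (2 * z.1, z.2)) (fun z => K' (2 * z.1 - 1, z.2))).
  + exact: continuous_fst.
  + apply: continuous_comp2 cH'.
    apply: continuous_pair; last exact: continuous_snd.
    exact: (continuous_comp2 (@continuous_fst _ _) continuous_dbl).
  + apply: continuous_comp2 cK'.
    apply: continuous_pair; last exact: continuous_snd.
    exact: (continuous_comp2 (@continuous_fst _ _) continuous_dblB1).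
  + move=> [s t] /= ->; rewrite /H' /K' /= half2 subrr.
    rewrite (clamp_id I01_0) (clamp_id I01_1).
    by rewrite H1 ?K0//; exact: clamp_in.
- move=> s t Is It /=; case: ifP => _; [apply: HX|apply: KX]; exact: clamp_in.
- move=> t It /=; rewrite invr_ge0 ler0n /H' /= mulr0.
  by rewrite !clamp_id ?H0//; exact: I01_0.
- move=> t It /=; rewrite half_le1 /K' /= two_sub1.
  by rewrite !clamp_id ?K1//; exact: I01_1.
- move=> s Is /=; case: ifP => sh; rewrite /H' /K' /=.
  + by rewrite (clamp_id I01_0) (clamp_id I01_1); apply: He; exact: clamp_in.
  + by rewrite (clamp_id I01_0) (clamp_id I01_1); apply: Ke; exact: clamp_in.
Qed.

Lemma homotopicb_trans : transitive homotopicb.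
Proof.
move=> g f h /asboolP fg /asboolP gh; apply/asboolP.
exact: homotopic_trans fg gh.
Qed.

Canonical homotopic_equiv :=
  EquivRel homotopicb homotopicb_refl homotopicb_sym homotopicb_trans.

Definition pi1 := {eq_quot homotopicb}.

HB.instance Definition _ := Choice.on pi1.
HB.instance Definition _ := EqQuotient.on pi1.

Lemma eq_pi1 (f g : loop) : \pi_pi1 f = \pi_pi1 g <-> homotopic f g.
Proof. by split=> [/eqmodP/asboolP|fg]; last exact/eqmodP/asboolP. Qed.

Lemma cst_loop_cts : {within I01, continuous (fun _ : R => pset_pt X)}.
Proof. by apply: continuous_subspaceT => t; exact: cvg_cst. Qed.

Definition cst_loop : loop :=
  @Loop (fun=> pset_pt X) cst_loop_cts (fun _ _ => pset_ptP X) erefl erefl.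

Definition cat_fun (f g : R -> T) (t : R) : T :=
  if t <= 2^-1 then f (2 * t) else g (2 * t - 1).

Section Cat.
Variables f g : loop.

Lemma cat_loop_cts : {within I01, continuous (cat_fun f g)}.
Proof.
pose h := fun t : R => if t <= 2^-1 then (f \o clamp) (2 * t)
                      else (g \o clamp) (2 * t - 1).
apply: (within_continuousE (f := h)).
  move=> t It; rewrite /h /cat_fun /=; case: ifP => th; rewrite clamp_id//.
    exact: I01_half1.
  exact: I01_half2.
apply: continuous_subspaceT.
apply: (@continuous_glue _ _ _ id 2^-1
  (fun t => (f \o clamp) (2 * t)) (fun t => (g \o clamp) (2 * t - 1))).
- by move=> t; exact: cvg_id.
- exact: (continuous_comp2 continuous_dbl (@loop_ext f)).
- exact: (continuous_comp2 continuous_dblB1 (@loop_ext g)).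
- move=> t /= ->; rewrite half2 subrr (clamp_id I01_0) (clamp_id I01_1).
  by rewrite loop_0 loop_1.
Qed.

Lemma cat_loop_in t : I01 t -> pset_car X (cat_fun f g t).
Proof.
move=> It; rewrite /cat_fun; case: ifP => th; apply: loop_in.
  exact: I01_half1.
exact: I01_half2.
Qed.

Lemma cat_loop_0 : cat_fun f g 0 = pset_pt X.
Proof. by rewrite /cat_fun invr_ge0 ler0n mulr0 loop_0. Qed.

Lemma cat_loop_1 : cat_fun f g 1 = pset_pt X.
Proof. by rewrite /cat_fun half_le1 two_sub1 loop_1. Qed.

(* f is traversed first, then g. *)
Definition cat_loop : loop :=
  Loop cat_loop_cts cat_loop_in cat_loop_0 cat_loop_1.

End Cat.

Section Rev.
Variable f : loop.

Lemma rev_loop_cts : {within I01, continuous (fun t => f (1 - t))}.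
Proof.
apply: (@within_continuous_comp _ _ _ _ I01 (fun t : R => 1 - t) f).
- by apply: continuous_subspaceT; exact: continuous_rev.
- exact: loop_cts.
- exact: I01_rev.
Qed.

Lemma rev_loop_in t : I01 t -> pset_car X (f (1 - t)).
Proof. by move=> It; apply: loop_in; exact: I01_rev. Qed.

Lemma rev_loop_0 : f (1 - 0) = pset_pt X.
Proof. by rewrite subr0 loop_1. Qed.

Lemma rev_loop_1 : f (1 - 1) = pset_pt X.
Proof. by rewrite subrr loop_0. Qed.

Definition rev_loop : loop :=
  Loop rev_loop_cts rev_loop_in rev_loop_0 rev_loop_1.

End Rev.

Lemma homotopic_cat f f' g g' :
  homotopic f f' -> homotopic g g' ->
  homotopic (cat_loop f g) (cat_loop f' g').
Proof.
case=> H [cH HX H0 H1 He] [K [cK KX K0 K1 Ke]].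
pose H' (z : R * R) := H (clamp z.1, clamp z.2).
pose K' (z : R * R) := K (clamp z.1, clamp z.2).
have cH' : continuous H' := homotopy_ext cH.
have cK' : continuous K' := homotopy_ext cK.
exists (fun z => if z.2 <= 2^-1 then H' (z.1, 2 * z.2)
                 else K' (z.1, 2 * z.2 - 1)).
split.
- apply: continuous_subspaceT.
  apply: (@continuous_glue _ _ _ (fun z : R * R => z.2) 2^-1
    (fun z => H' (z.1, 2 * z.2)) (fun z => K' (z.1, 2 * z.2 - 1))).
  + exact: continuous_snd.
  + apply: continuous_comp2 cH'.
    apply: continuous_pair; first exact: continuous_fst.
    exact: (continuous_comp2 (@continuous_snd _ _) continuous_dbl).
  + apply: continuous_comp2 cK'.
    apply: continuous_pair; first exact: continuous_fst.
    exact: (continuous_comp2 (@continuous_snd _ _) continuous_dblB1).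
  + move=> [s t] /= ->; rewrite /H' /K' /= half2 subrr.
    rewrite (clamp_id I01_0) (clamp_id I01_1).
    by rewrite (He _ (clamp_in s)).2 (Ke _ (clamp_in s)).1.
- move=> s t Is It /=; case: ifP => _; [apply: HX|apply: KX]; exact: clamp_in.
- move=> t It /=; rewrite /cat_fun /H' /K' /= (clamp_id I01_0).
  by case: ifP => th; rewrite clamp_id ?H0 ?K0//;
    by [exact: I01_half1|exact: I01_half2].
- move=> t It /=; rewrite /cat_fun /H' /K' /= (clamp_id I01_1).
  by case: ifP => th; rewrite clamp_id ?H1 ?K1//;
    by [exact: I01_half1|exact: I01_half2].
- move=> s Is; split=> /=.
    rewrite invr_ge0 ler0n mulr0 /H' /= (clamp_id I01_0).
    exact: (He _ (clamp_in s)).1.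
  rewrite half_le1 two_sub1 /K' /= (clamp_id I01_1).
  exact: (Ke _ (clamp_in s)).2.
Qed.

Lemma homotopic_rev f f' : homotopic f f' ->
  homotopic (rev_loop f) (rev_loop f').
Proof.
case=> H [cH HX H0 H1 He].
exists (fun z => H (z.1, 1 - z.2)); split.
- apply: (@within_continuous_comp _ _ _ _ _
    (fun z : R * R => (z.1, 1 - z.2)) H _ cH).
    apply: continuous_subspaceT; apply: continuous_pair;
      first exact: continuous_fst.
    exact: (continuous_comp2 (@continuous_snd _ _) continuous_rev).
  by move=> z /= [z1 z2]; split=> //=; exact: I01_rev.
- by move=> s t Is It; apply: HX => //; exact: I01_rev.
- by move=> t It /=; rewrite H0//; exact: I01_rev.
- by move=> t It /=; rewrite H1//; exact: I01_rev.
- by move=> s Is /=; rewrite subr0 subrr; have [-> ->] := He _ Is.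
Qed.

Lemma continuous_maxf (p q : R -> R) : continuous p -> continuous q ->
  continuous (fun t => Num.max (p t) (q t)).
Proof. by move=> cp cq t; exact: (@continuous_max _ _ p q t (cp t) (cq t)). Qed.

Lemma continuous_minf (p q : R -> R) : continuous p -> continuous q ->
  continuous (fun t => Num.min (p t) (q t)).
Proof. by move=> cp cq t; exact: (@continuous_min _ _ p q t (cp t) (cq t)). Qed.

Lemma continuous_affine (a b : R) : continuous (fun t : R => a * t + b).
Proof.
move=> t; apply: cvgD; last exact: cvg_cst.
by apply: cvgM; [exact: cvg_cst|exact: cvg_id].
Qed.

Lemma homotopic_catA f g h :
  homotopic (cat_loop f (cat_loop g h)) (cat_loop (cat_loop f g) h).
Proof.
pose p (t : R) := Num.max (Num.max (2^-1 * t + 0) (1 * t + - 4^-1)) (2 * t - 1).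
have cp : continuous p.
  apply: continuous_maxf; last exact: continuous_affine.
  by apply: continuous_maxf; exact: continuous_affine.
have pE t : p t = if t <= 2^-1 then 2^-1 * t
                  else if t <= 3 / 4 then t - 4^-1 else 2 * t - 1.
  rewrite /p addr0 mul1r; case: ifPn => [th|]; last case: ifPn => [th|].
  - by rewrite max_l ?max_l//; lra.
  - by rewrite -ltNge => th'; rewrite (max_r (x := 2^-1 * t)) ?max_l//; lra.
  - by rewrite -!ltNge => th th'; rewrite max_r// ge_max; apply/andP; lra.
apply: (@homotopic_reparam (cat_loop (cat_loop f g) h) _ _ p id) => //.
- by move=> t; exact: cvg_id.
- move=> t /I01P t01; apply/I01P; rewrite pE.
  by case: (lerP t 2^-1) => th; last case: (lerP t (3 / 4)) => th'; lra.
- by rewrite pE invr_ge0 ler0n mulr0.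
- rewrite pE half_le1 two_sub1 ifF//; apply/negbTE; rewrite -ltNge; lra.
- move=> t _; rewrite pE /= /cat_fun.
  case: (lerP t 2^-1) => th.
    rewrite !ifT//; [|lra|lra].
    by congr (f _); lra.
  have -> : (2 * t - 1 <= 2^-1) = (t <= 3 / 4) by apply/idP/idP; lra.
  case: (lerP t (3 / 4)) => th'.
    rewrite ifT; last lra.
    rewrite ifF; last by apply/negbTE; rewrite -ltNge; lra.
    by congr (g _); lra.
  by rewrite ifF//; apply/negbTE; rewrite -ltNge; lra.
Qed.

Lemma homotopic_cat1l f : homotopic (cat_loop cst_loop f) f.
Proof.
pose p (t : R) := Num.max 0 (2 * t - 1).
apply: (@homotopic_reparam f _ _ p id) => //.
- apply: continuous_maxf; last exact: continuous_affine.
  by move=> t; exact: cvg_cst.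
- by move=> t; exact: cvg_id.
- move=> t /I01P t01; apply/I01P; rewrite /p le_max lexx/= ge_max ler01/=; lra.
- by rewrite /p max_l//; lra.
- by rewrite /p max_r//; lra.
- move=> t _; rewrite /= /cat_fun /p; case: (lerP t 2^-1) => th.
    by rewrite max_l ?loop_0//; lra.
  by rewrite max_r//; lra.
Qed.

Lemma homotopic_cat1r f : homotopic (cat_loop f cst_loop) f.
Proof.
pose p (t : R) := Num.min 1 (2 * t + 0).
apply: (@homotopic_reparam f _ _ p id) => //.
- apply: continuous_minf; last exact: continuous_affine.
  by move=> t; exact: cvg_cst.
- by move=> t; exact: cvg_id.
- move=> t /I01P t01; apply/I01P; rewrite /p ge_min lexx/= le_min ler01/=; lra.
- by rewrite /p min_r//; lra.
- by rewrite /p min_l//; lra.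
- move=> t _; rewrite /= /cat_fun /p addr0.
  case: (lerP t 2^-1) => th.
    by rewrite min_r//; lra.
  by rewrite min_l ?loop_1//; lra.
Qed.

Lemma homotopic_catVl f : homotopic (cat_loop (rev_loop f) f) cst_loop.
Proof.
pose p (t : R) := Num.max (- 2 * t + 1) (2 * t - 1).
apply: (@homotopic_reparam f _ _ p (fun=> 1)) => //.
- by apply: continuous_maxf; exact: continuous_affine.
- by move=> t; exact: cvg_cst.
- move=> t /I01P t01; apply/I01P; rewrite /p le_max ge_max.
  by case: (lerP t 2^-1) => th; apply/andP; split; try apply/orP; lra.
- by move=> t _; exact: I01_1.
- by rewrite /p max_l; lra.
- by rewrite /p max_r; lra.
- move=> t _; rewrite /= /cat_fun /p; case: (lerP t 2^-1) => th.
    by rewrite max_l; [congr (f _)|]; lra.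
  by rewrite max_r//; lra.
- by move=> t _; rewrite loop_1.
Qed.

Lemma homotopic_catVr f : homotopic (cat_loop f (rev_loop f)) cst_loop.
Proof.
pose p (t : R) := Num.min (2 * t + 0) (- 2 * t + 2).
apply: (@homotopic_reparam f _ _ p (fun=> 0)) => //.
- by apply: continuous_minf; exact: continuous_affine.
- by move=> t; exact: cvg_cst.
- move=> t /I01P t01; apply/I01P; rewrite /p le_min ge_min.
  by case: (lerP t 2^-1) => th; apply/andP; split; try apply/orP; lra.
- by move=> t _; exact: I01_0.
- by rewrite /p min_l; lra.
- by rewrite /p min_r; lra.
- move=> t _; rewrite /= /cat_fun /p; case: (lerP t 2^-1) => th.
    by rewrite min_l; [congr (f _)|]; lra.
  by rewrite min_r; [congr (f _)|]; lra.
- by move=> t _; rewrite loop_0.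
Qed.

Definition pi1_one : pi1 := \pi_pi1 cst_loop.
Definition pi1_inv (a : pi1) : pi1 := \pi_pi1 (rev_loop (repr a)).
Definition pi1_mul (a b : pi1) : pi1 :=
  \pi_pi1 (cat_loop (repr a) (repr b)).

Lemma pi1_invE f : pi1_inv (\pi_pi1 f) = \pi_pi1 (rev_loop f).
Proof. by apply/eq_pi1/homotopic_rev/eq_pi1; rewrite reprK. Qed.

Lemma pi1_mulE f g :
  pi1_mul (\pi_pi1 f) (\pi_pi1 g) = \pi_pi1 (cat_loop f g).
Proof. by apply/eq_pi1/homotopic_cat; apply/eq_pi1; rewrite reprK. Qed.

Lemma pi1_mulA : associative pi1_mul.
Proof.
elim/quotW=> f; elim/quotW=> g; elim/quotW=> h.
rewrite (pi1_mulE g h) (pi1_mulE f g) (pi1_mulE f) (pi1_mulE _ h).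
exact/eq_pi1/homotopic_catA.
Qed.

Lemma pi1_mul1g : left_id pi1_one pi1_mul.
Proof.
by elim/quotW=> f; rewrite (pi1_mulE _ f); exact/eq_pi1/homotopic_cat1l.
Qed.

Lemma pi1_mulg1 : right_id pi1_one pi1_mul.
Proof.
by elim/quotW=> f; rewrite (pi1_mulE f); exact/eq_pi1/homotopic_cat1r.
Qed.

Lemma pi1_mulVg : left_inverse pi1_one pi1_inv pi1_mul.
Proof.
elim/quotW=> f; rewrite (pi1_invE f) (pi1_mulE _ f).
exact/eq_pi1/homotopic_catVl.
Qed.

Lemma pi1_mulgV : right_inverse pi1_one pi1_inv pi1_mul.
Proof.
elim/quotW=> f; rewrite (pi1_invE f) (pi1_mulE f).
exact/eq_pi1/homotopic_catVr.
Qed.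

HB.instance Definition _ := isGroup.Build pi1
  pi1_mulA pi1_mul1g pi1_mulg1 pi1_mulVg pi1_mulgV.

End Loop.

Arguments loop R {T} X.
Arguments pi1 R {T} X.

Section Pi1Map.
Context {R : realType} {T U : topologicalType} (X : pset T) (Y : pset U).

Record pmap := PMap {
  pmap_fun :> T -> U;
  pmap_cts : {within pset_car X, continuous pmap_fun};
  pmap_in : forall z, pset_car X z -> pset_car Y (pmap_fun z);
  pmap_pt : pmap_fun (pset_pt X) = pset_pt Y }.

Variable phi : pmap.

Section MapLoop.
Variable f : loop R X.

Lemma map_loop_cts : {within I01, continuous (phi \o f)}.
Proof.
exact: within_continuous_comp (@loop_cts _ _ _ f) (@pmap_cts phi) (@loop_in _ _ _ f).
Qed.

Lemma map_loop_in t : I01 t -> pset_car Y ((phi \o f) t).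
Proof. by move=> It; apply/pmap_in/loop_in. Qed.

Lemma map_loop_0 : (phi \o f) 0 = pset_pt Y.
Proof. by rewrite /= loop_0 pmap_pt. Qed.

Lemma map_loop_1 : (phi \o f) 1 = pset_pt Y.
Proof. by rewrite /= loop_1 pmap_pt. Qed.

Definition map_loop : loop R Y :=
  Loop map_loop_cts map_loop_in map_loop_0 map_loop_1.

End MapLoop.

Lemma homotopic_map (f g : loop R X) :
  homotopic f g -> homotopic (map_loop f) (map_loop g).
Proof.
case=> H [cH HX H0 H1 He]; exists (phi \o H); split.
- apply: within_continuous_comp cH (@pmap_cts phi) _ => -[s t] [/= Is It].
  exact: HX.
- by move=> s t Is It; apply/pmap_in/HX.
- by move=> t It /=; rewrite H0.
- by move=> t It /=; rewrite H1.
- by move=> s Is /=; have [-> ->] := He _ Is; rewrite pmap_pt.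
Qed.

Definition pi1_map (a : pi1 R X) : pi1 R Y := \pi_(pi1 R Y) (map_loop (repr a)).

Lemma pi1_mapE (f : loop R X) :
  pi1_map (\pi_(pi1 R X) f) = \pi_(pi1 R Y) (map_loop f).
Proof. by apply/eq_pi1/homotopic_map/eq_pi1; rewrite reprK. Qed.

Lemma pi1_mapM (a b : pi1 R X) : pi1_map (a * b)%g = (pi1_map a * pi1_map b)%g.
Proof.
elim/quotW: a => f; elim/quotW: b => g.
rewrite [(_ * _)%g](pi1_mulE f g) !pi1_mapE.
rewrite [(_ * _)%g](pi1_mulE (map_loop f) (map_loop g)).
apply/eq_pi1/homotopic_eq => t _ /=; rewrite /cat_fun.
by case: ifP.
Qed.

End Pi1Map.

Section NormalClosure.
Context {G : groupType}.

Definition normal_subgroup (N : set G) : Prop :=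
  [/\ N 1%g,
      (forall a b, N a -> N b -> N (a * b)%g),
      (forall a, N a -> N (a^-1)%g)
    & (forall a g, N a -> N (a ^ g)%g)].

Definition normal_closure (A : set G) : set G := smallest normal_subgroup A.

Definition relator (a b : G) : G := (a / b)%g.

End NormalClosure.

(* R[i] is given the topology of its modulus, which takes values in R[i];     *)
(* the library declares it on the alias R[i]^o only.                          *)
HB.instance Definition _ (R : realType) := NormedModule.copy R[i] R[i]^o.

Section Smooth.
Context {R : realType}.
Local Notation C := R[i].
Implicit Types (U : set (R * R)) (u v : R * R -> R) (A : set C) (f g : C -> C).

Fixpoint is_Ck (k : nat) U u : Prop :=
  {in U, continuous u} /\
  if k is k'.+1 then
    forall e : R * R, e = (1, 0) \/ e = (0, 1) ->
      (forall z, U z -> derivable u z e) /\ is_Ck k' U ('D_e u)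
  else True.

Definition is_Coo U u : Prop := forall k, is_Ck k U u.

(* As usual for a subset that need not be open, f is smooth on A if near      *)
(* every point of A it coincides on A with a smooth map of an open set.       *)
Definition smooth_on A f : Prop :=
  forall z, A z -> exists U u v,
    [/\ open U, U (complex.Re z, complex.Im z), is_Coo U u, is_Coo U v
      & forall a b, U (a, b) -> A (a +i* b) ->
          f (a +i* b) = u (a, b) +i* v (a, b)].

Definition diffeo A f : Prop :=
  exists g, [/\ smooth_on A f, smooth_on A g,
    (forall z, A z -> A (f z) /\ A (g z)),
    (forall z, A z -> g (f z) = z)
  & (forall z, A z -> f (g z) = z)].

Lemma continuous_ReIm : continuous (fun z : C => (complex.Re z, complex.Im z)).
Proof.
apply: continuous_pair => z.
- apply/(@cvgrPdist_lt _ R^o _ (nbhs z) (nbhs_filter z) (@complex.Re R)) => e e0.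
  have eC : (0 : C) < e%:C by rewrite ltcR.
  apply: (@filterS _ (nbhs z) _ (ball z e%:C)); last exact: nbhsx_ballx.
  move=> w; rewrite -ball_normE /= => zw.
  rewrite -ltcR (le_lt_trans _ zw)//.
  by have := normc_ge_Re (z - w); rewrite raddfB.
- apply/(@cvgrPdist_lt _ R^o _ (nbhs z) (nbhs_filter z) (@complex.Im R)) => e e0.
  have eC : (0 : C) < e%:C by rewrite ltcR.
  apply: (@filterS _ (nbhs z) _ (ball z e%:C)); last exact: nbhsx_ballx.
  move=> w; rewrite -ball_normE /= => zw.
  rewrite -ltcR (le_lt_trans _ zw)//.
  case: z w {zw} => a b [c d]; rewrite normc_def /= lecR -sqrtr_sqr.
  by rewrite ler_wsqrtr// lerDr sqr_ge0.
Qed.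

Lemma continuous_mkC : continuous (fun p : R * R => p.1 +i* p.2 : C).
Proof.
move=> [a b]; apply/cvgrPdist_lt => e e0.
have eR : e = (complex.Re e)%:C by rewrite RRe_real// gtr0_real.
move: e0; rewrite eR ltcR => e0; near=> p => /=.
have -> : a +i* b - (p.1 +i* p.2) = (a - p.1)%:C + 'i * (b - p.2)%:C :> C.
  by simpc.
apply: le_lt_trans (ler_normD _ _) _.
rewrite normrM normCi mul1r !normc_def /= !expr0n /= !addr0 !sqrtr_sqr.
rewrite -rmorphD ltcR [ltRHS]splitr ltrD//.
- near: p; apply: (@cvgr_dist_lt _ R^o _ _ _ fst a); last exact: divr_gt0.
  exact: cvg_fst.
- near: p; apply: (@cvgr_dist_lt _ R^o _ _ _ snd b); last exact: divr_gt0.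
  exact: cvg_snd.
Unshelve. all: by end_near.
Qed.

Lemma smooth_on_continuous A f : smooth_on A f -> {within A, continuous f}.
Proof.
move=> sf; apply/subspace_continuousP => z Az.
have [U [u [v [oU Uz su sv fE]]]] := sf z Az.
pose F (w : C) : C :=
  u (complex.Re w, complex.Im w) +i* v (complex.Re w, complex.Im w).
have cF : {for z, continuous F}.
  have cu : {for (complex.Re z, complex.Im z), continuous u}.
    by have [+ _] := su 0%N; apply; rewrite inE.
  have cv : {for (complex.Re z, complex.Im z), continuous v}.
    by have [+ _] := sv 0%N; apply; rewrite inE.
  apply: (@continuous_comp _ _ _
    (fun w : C => (u (complex.Re w, complex.Im w), v (complex.Re w, complex.Im w)))
    (fun p : R * R => p.1 +i* p.2 : C)); last exact: continuous_mkC.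
  apply: (@cvg_pair _ _ _ (nbhs z) (nbhs (u _)) (nbhs (v _))).
  - exact: (continuous_comp (continuous_ReIm (x := z)) cu).
  - exact: (continuous_comp (continuous_ReIm (x := z)) cv).
have Ez : f z = F z.
  by move: fE; case: z Az Uz {cF} => a b Az Uz fE; rewrite fE.
move=> W Wfz; have {Wfz} /cF FW : nbhs (F z) W by rewrite -Ez.
have UW : nbhs z (fun w : C => U (complex.Re w, complex.Im w)).
  by apply: continuous_ReIm; exact: open_nbhs_nbhs.
apply: (@filterS2 _ (nbhs z) _ _ _ _ _ FW UW) => -[a b] FWw Uw Aw.
by have := FWw; rewrite /F /= -fE.
Qed.

End Smooth.

Section Braid.
Context {R : realType}.
Local Notation C := R[i].

Definition cis (a : R) : C := cos a +i* sin a.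

Definition disk : set C := [set y | `|y| <= 4].
Definition disk_boundary : set C := [set y | `|y| = 4].
Definition base_pt : C := 0 -i* 4.

Lemma base_pt_boundary : disk_boundary base_pt.
Proof.
rewrite /disk_boundary /= normc_def /= expr0n add0r sqrrN sqrtr_sqr.
by rewrite ger0_norm// (rmorph_nat (real_complex R)).
Qed.

Lemma base_pt_disk : disk base_pt.
Proof. by rewrite /disk /= (base_pt_boundary : `|_| = _). Qed.

Record config := Config {
  config_set :> set C;
  config_sub : config_set `<=` disk;
  config_base : ~ config_set base_pt }.

Definition punctured_disk (K : config) : pset C :=
  @PSet C (disk `\` K) base_pt (conj base_pt_disk (config_base (c := K))).

Record disk_diffeo (K : config) := DiskDiffeo {
  dd_fun :> C -> C;
  dd_diffeo : diffeo disk dd_fun;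
  dd_config : dd_fun @` K = K;
  dd_boundary : forall y, disk_boundary y -> dd_fun y = y }.

Section Induced.
Variables (K : config) (f : disk_diffeo K).

Lemma dd_cts : {within pset_car (punctured_disk K), continuous f}.
Proof.
apply: (@continuous_subspaceW _ _ _ disk); first by move=> y [].
by apply: smooth_on_continuous; case: (dd_diffeo f) => g [].
Qed.

Lemma dd_in y :
  pset_car (punctured_disk K) y -> pset_car (punctured_disk K) (f y).
Proof.
case: (dd_diffeo f) => g [_ _ fgD gK _] [Dy nKy].
split; first by have [] := fgD _ Dy.
rewrite -[X in X (f y)](dd_config f) => -[k Kk fky].
suff yk : k = y by apply: nKy; rewrite -yk.
by rewrite -(gK y Dy) -fky (gK k (config_sub Kk)).
Qed.

Lemma dd_pt :
  f (pset_pt (punctured_disk K)) = pset_pt (punctured_disk K).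
Proof. exact/dd_boundary/base_pt_boundary. Qed.

Definition dd_pmap : pmap (punctured_disk K) (punctured_disk K) :=
  PMap dd_cts dd_in dd_pt.

Definition dd_pi1 : pi1 R (punctured_disk K) -> pi1 R (punctured_disk K) :=
  pi1_map dd_pmap.

End Induced.

Section BraidType.
Variable K : config.

HB.instance Definition _ := gen_eqMixin (disk_diffeo K).
HB.instance Definition _ := gen_choiceMixin (disk_diffeo K).

Definition braid_equiv (f g : disk_diffeo K) : bool := `[< dd_pi1 f =1 dd_pi1 g >].

Lemma braid_equiv_refl : reflexive braid_equiv.
Proof. by move=> f; exact/asboolP. Qed.

Lemma braid_equiv_sym : symmetric braid_equiv.
Proof. by move=> f g; apply/asboolP/asboolP => fg a; rewrite fg. Qed.

Lemma braid_equiv_trans : transitive braid_equiv.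
Proof.
by move=> g f h /asboolP fg /asboolP gh; apply/asboolP => a; rewrite fg gh.
Qed.

Canonical braid_equiv_equiv :=
  EquivRel braid_equiv braid_equiv_refl braid_equiv_sym braid_equiv_trans.

(* B_n[D, K] as a set: diffeomorphisms inducing the same automorphism of      *)
(* pi_1 (D - K) are identified. Its group law is not needed.                  *)
Definition braid := {eq_quot braid_equiv}.

HB.instance Definition _ := Choice.on braid.
HB.instance Definition _ := EqQuotient.on braid.

Definition braid_class (f : disk_diffeo K) : braid := \pi_braid f.

Definition braid_aut (b : braid) :
    pi1 R (punctured_disk K) -> pi1 R (punctured_disk K) :=
  dd_pi1 (repr b).

Lemma braid_autE (f : disk_diffeo K) : braid_aut (braid_class f) =1 dd_pi1 f.
Proof. by apply/asboolP; have /eqmodP := reprK (braid_class f). Qed.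

Section Motion.
Variable n : nat.

Definition is_motion (m : 'I_n -> R -> C) : Prop :=
  [/\ (forall i, {within I01, continuous (m i)}),
      (forall i t, I01 t -> disk (m i t)),
      (forall i j t, I01 t -> i != j -> m i t <> m j t),
      [set m i 0 | i in [set: 'I_n]] = K
    & [set m i 1 | i in [set: 'I_n]] = K].

Definition realizes (d : R -> C -> C) (m : 'I_n -> R -> C) : Prop :=
  [/\ {within I01 `*` disk, continuous (fun z : R * C => d z.1 z.2)},
      (forall t, I01 t -> diffeo disk (d t)),
      (forall t y, I01 t -> disk_boundary y -> d t y = y),
      (forall y, disk y -> d 0 y = y)
    & (forall i t, I01 t -> d t (m i 0) = m i t)].

Definition induced_by_motion (m : 'I_n -> R -> C) (b : braid) : Prop :=
  is_motion m /\
  exists d (f : disk_diffeo K),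
    [/\ realizes d m, (forall y, disk y -> f y = d 1 y) & b = braid_class f].

(* q is the point of the segment from u to p at distance e from p.            *)
Definition lasso (u p : C) (e : R) (t : R) : C :=
  let q := p + e%:C / `|u - p| * (u - p) in
  if t <= 1 / 3 then u + (3 * t)%:C * (q - u)
  else if t <= 2 / 3 then
    p + cis (2 * pi * (3 * t - 1)) * (q - p)
  else q + (3 * t - 2)%:C * (u - q).

Definition lasso_class (p : C) (a : pi1 R (punctured_disk K)) : Prop :=
  exists (e : R) (l : loop R (punctured_disk K)),
    [/\ 0 < e,
        (forall y, `|y - p| <= e%:C -> disk y /\ (config_set K y -> y = p)),
        (forall t, I01 t -> l t = lasso base_pt p e t)
      & a = \pi_(pi1 R (punctured_disk K)) l].

Definition standard_gbase (x : 'I_n -> pi1 R (punctured_disk K)) : Prop :=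
  exists p : 'I_n -> R,
    [/\ (forall i j : 'I_n, (i < j)%N -> p i < p j),
        [set (p i)%:C | i in [set: 'I_n]] = K
      & (forall i, lasso_class (p i)%:C (x i))].

Definition braid_relators (b : braid) (x : 'I_n -> pi1 R (punctured_disk K)) :
    set (pi1 R (punctured_disk K)) :=
  [set relator (braid_aut b (x j)) (x j) | j in [set: 'I_n]].

End Motion.

Definition fiber (S : set (C * C)) (x : C) : set C := [set y | S (x, y)].

(* The initial condition at t = 0 forces K to be the fiber of S over 1; n is  *)
(* then the number of points of each fiber over the unit circle.              *)
Definition local_braid_monodromy (S : set (C * C)) (b : braid) : Prop :=
  exists n (m : 'I_n -> R -> C),
    (forall t, I01 t ->
       [set m i t | i in [set: 'I_n]] = fiber S (cis (2 * pi * t))) /\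
    induced_by_motion m b.

End BraidType.

Definition rotation_motion (n : nat) (p : 'I_n -> C) (a : R) (i : 'I_n) (t : R) :
    C := cis (a * t) * p i.

(* A point z is (x, y), in the product of the unit disk and of the disk of     *)
(* radius 4.                                                                  *)
Definition tangency_curve : set (C * C) :=
  [set z | [/\ `|z.1| <= 1, disk z.2
             & (z.2 + z.1 ^+ 2) * (z.2 - z.1 ^+ 2) = 0]].

Lemma tangency_sub : fiber tangency_curve 1 `<=` disk.
Proof. by move=> y []. Qed.

Lemma tangency_base : ~ fiber tangency_curve 1 base_pt.
Proof.
case=> _ _ /=; rewrite /base_pt; simpc.
move=> /eqP; rewrite eq_complex /= => /andP[+ _].
by apply/negP; rewrite lt_eqF//; lra.
Qed.

Definition tangency_config : config := Config tangency_sub tangency_base.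

End Braid.

(* Main.v *)
(* The rotation of the punctures through 4 pi is realized by the twist         *)
(* T_s y = cis (4 pi s (16 - |y|^2) / 15) y, which fixes the circle            *)
(* |y| = 4. By the intermediate value theorem the points of the curve over     *)
(* cis (2 pi t) move only in this way, and any realization is isotopic to T,   *)
(* so T_1 is the monodromy. Following T_s by the rotation of angle -4 pi s     *)
(* gives an isotopy R_s from the identity to T_1 = R_1 that fixes the          *)
(* punctures and drags the base point twice clockwise along the boundary;      *)
(* hence T_1 acts on pi_1 as conjugation by b^-2, b being the boundary loop.   *)
(* A straight-line homotopy shows b = x2 x1, and the relations say that        *)
(* (x2 x1)^2 commutes with x1, hence with x2.                                  *)

Require Import Defs.
From HB Require Import structures.
From mathcomp Require Import all_boot all_order all_algebra complex.
From mathcomp Require Import boolp classical_sets functions reals.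
From mathcomp Require Import topology normedtype derive trigo.
From mathcomp Require Import realfun ring lra.

Set Implicit Arguments.
Unset Strict Implicit.
Unset Printing Implicit Defensive.

Import Order.TTheory GRing.Theory Num.Theory numFieldNormedType.Exports.

Local Open Scope classical_set_scope.
Local Open Scope ring_scope.
Local Open Scope complex_scope.

(** Over [cis (2 * pi * t)] the fiber is [cis (4 * pi * t)] and its opposite, so each continuous
    strand is a rigid rotation ([fiber_motion_rotates]). Braids are compared by their action on
    [pi1], and two realizations of one motion differ by an isotopy that fixes the punctures and the
    base point, so the explicit twist computes the monodromy ([braid_of_rotation],
    [tangency_braid_monodromy]).

    The twist also ends a second isotopy, which fixes the punctures and turns the boundary
    ([twist_1]). Along it a loop [g] undergoes a free homotopy to its image, and the track of the
    base point turns this into a conjugation by a power of the boundary loop ([homotopic_free],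
    [double_full_twist_conj]).

    The geometric input is [standard_gbase_product], which writes the boundary loop as [x2 * x1]; it
    rests on a segment avoiding the punctures ([lasso_avoid]). The normal closures are then compared
    by group algebra inside [pi1] ([normal_closure_conj_product]). *)

Section Terms.
Context {R : realType}.

(* A syntax for functions of (x, y) stable under partial derivatives, whence  *)
(* all of them are smooth by induction on the order alone.                    *)
Inductive term :=
  | TCst of R
  | TVar of bool
  | TAdd of term & term
  | TMul of term & term
  | TSin of term
  | TCos of term.

Fixpoint teval (a : term) (z : R * R) : R :=
  match a with
  | TCst c => c
  | TVar b => if b then z.2 else z.1
  | TAdd a b => teval a z + teval b z
  | TMul a b => teval a z * teval b z
  | TSin a => sin (teval a z)
  | TCos a => cos (teval a z)
  end.

Fixpoint tderiv (e : R * R) (a : term) : term :=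
  match a with
  | TCst c => TCst 0
  | TVar b => TCst (if b then e.2 else e.1)
  | TAdd a b => TAdd (tderiv e a) (tderiv e b)
  | TMul a b => TAdd (TMul a (tderiv e b)) (TMul b (tderiv e a))
  | TSin a => TMul (TCos a) (tderiv e a)
  | TCos a => TMul (TMul (TCst (-1)) (TSin a)) (tderiv e a)
  end.

Lemma continuous_teval a : continuous (teval a).
Proof.
elim: a => [c|[]|a iha b ihb|a iha b ihb|a iha|a iha] z /=.
- exact: cvg_cst.
- exact: cvg_snd.
- exact: cvg_fst.
- by apply: cvgD; [exact: iha|exact: ihb].
- by apply: cvgM; [exact: iha|exact: ihb].
- by apply: continuous_comp; [exact: iha|exact: continuous_sin].
- by apply: continuous_comp; [exact: iha|exact: continuous_cos].
Qed.

(** Reduces directional derivatives to one real variable, where the chain rule for [sin] and [cos]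
    applies. *)
Lemma is_derive_line (f : R * R -> R) (z e : R * R) (d : R) :
  is_derive (0 : R) 1 (fun h => f (h *: e + z)) d <-> is_derive z e f d.
Proof.
have E : (fun h : R => h^-1 *: (f ((h%:A + 0 : R) *: e + z) - f ((0 : R) *: e + z)))
    = (fun h : R => h^-1 *: (f (h *: e + z) - f z)).
  by apply/funext => h; rewrite scale0r add0r addr0 [h%:A]mulr1.
by split=> -[dv vE]; split; move: dv vE; rewrite /derivable /derive /= /comp /shift E.
Qed.

Lemma is_derive_comp (g : R -> R) (f : R * R -> R) (z e : R * R) (d g' : R) :
  is_derive (f z) 1 g g' -> is_derive z e f d ->
  is_derive z e (fun w => g (f w)) (g' * d).
Proof.
move=> dg /is_derive_line df; apply/is_derive_line.
have dg0 : is_derive (f ((0 : R) *: e + z)) 1 g g' by rewrite scale0r add0r.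
exact: (@is_derive1_comp R g (fun h => f (h *: e + z)) 0 g' d).
Qed.

Lemma is_derive_teval (a : term) (z e : R * R) :
  is_derive z e (teval a) (teval (tderiv e a) z).
Proof.
elim: a => [c|b|a iha b ihb|a iha b ihb|a iha|a iha] /=.
- exact: is_derive_cst.
- apply/is_derive_line; case: b => /=.
  + have -> : (fun h : R => h * e.2 + z.2) = (fun h : R => e.2 *: h + z.2).
      by apply/funext => h; rewrite mulrC.
    by apply: is_derive_eq; rewrite addr0 scaler1.
  + have -> : (fun h : R => h * e.1 + z.1) = (fun h : R => e.1 *: h + z.1).
      by apply/funext => h; rewrite mulrC.
    by apply: is_derive_eq; rewrite addr0 scaler1.
- exact: is_deriveD.
- exact: (is_deriveM iha ihb).
- exact: (is_derive_comp (is_derive_sin _)).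
- rewrite mulN1r; exact: (is_derive_comp (is_derive_cos _)).
Qed.

Lemma is_Coo_teval U a : is_Coo U (teval a).
Proof.
move=> k; elim: k a => [|k ih] a /=; split=> //.
- by move=> z _; exact: continuous_teval.
- by move=> z _; exact: continuous_teval.
- move=> e _; split.
    by move=> z _; case: (is_derive_teval a z e).
  have -> : 'D_e (teval a) = teval (tderiv e a); last exact: ih.
  by apply/funext => z; case: (is_derive_teval a z e).
Qed.

End Terms.

(** * Squared modulus, rotations, and continuity of complex-valued maps *)

Section ComplexPlane.
Context {R : realType}.
Local Notation C := R[i].
Implicit Types (z w : C) (a b : R).

(** The modulus takes values in [R[i]]; its square taken in [R] makes conditions on it polynomial in
    the real coordinates. *)
Definition nsq z : R := complex.Re z ^+ 2 + complex.Im z ^+ 2.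

Lemma nsqM z w : nsq (z * w) = nsq z * nsq w.
Proof. by case: z w => [a b] [c d]; rewrite /nsq /=; ring. Qed.

Lemma normc_le_real z (e : R) : 0 <= e -> (`|z| <= e%:C) = (nsq z <= e ^+ 2).
Proof.
move=> e0; rewrite normc_def lecR -[X in _ <= X]ger0_norm// -sqrtr_sqr.
by rewrite ler_sqrt// sqr_ge0.
Qed.

Lemma normc_eq_real z (e : R) : 0 <= e -> (`|z| == e%:C) = (nsq z == e ^+ 2).
Proof.
move=> e0; rewrite normc_def eq_complex /= eqxx andbT -[X in _ == X]ger0_norm//.
by rewrite -sqrtr_sqr eqr_sqrt// ?sqr_ge0// addr_ge0 ?sqr_ge0.
Qed.

Lemma natC n : n%:R = (n%:R : R)%:C.
Proof. by rewrite (rmorph_nat (real_complex R)). Qed.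

Lemma diskP z : disk z <-> nsq z <= 16.
Proof. by rewrite /disk /= natC normc_le_real// -natrX. Qed.

Lemma disk_boundaryP z : disk_boundary z <-> nsq z = 16.
Proof.
rewrite /disk_boundary /= natC.
have e : (`|z| == 4%:R%:C) = (nsq z == 16) by rewrite normc_eq_real// -natrX.
by split=> /eqP ?; apply/eqP; rewrite ?e// -e.
Qed.

Lemma cisD a b : cis (a + b) = cis a * cis b.
Proof. by rewrite /cis cosD sinD; simpc; congr (_ +i* _); ring. Qed.

Lemma cis0 : cis 0 = 1 :> C.
Proof. by rewrite /cis cos0 sin0. Qed.

Lemma cispi : cis pi = - 1 :> C.
Proof. by rewrite /cis cospi sinpi; simpc. Qed.

Lemma cis2pi : cis (2 * pi) = 1 :> C.
Proof. by rewrite mulrDl mul1r cisD cispi mulrNN mulr1. Qed.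

Lemma cis4pi : cis (4 * pi) = 1 :> C.
Proof.
have -> : 4 * pi = 2 * pi + 2 * pi :> R by ring.
by rewrite cisD cis2pi mulr1.
Qed.

Lemma cisK a : cis (- a) * cis a = 1.
Proof. by rewrite -cisD addNr cis0. Qed.

Lemma nsq_cis a : nsq (cis a) = 1.
Proof. exact: cos2Dsin2. Qed.

Section Continuity.
Variable S : topologicalType.
Implicit Types f g : S -> C.

Lemma continuousC f : continuous (fun x => complex.Re (f x)) ->
  continuous (fun x => complex.Im (f x)) -> continuous f.
Proof.
move=> cr ci.
have -> : f = fun x => complex.Re (f x) +i* complex.Im (f x).
  by apply/funext => x; case: (f x).
exact: (continuous_comp2 (continuous_pair cr ci) (@continuous_mkC R)).
Qed.

Lemma continuous_Re f : continuous f -> continuous (fun x => complex.Re (f x)).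
Proof.
move=> cf.
exact: (continuous_comp2 (continuous_comp2 cf continuous_ReIm) (@continuous_fst _ _)).
Qed.

Lemma continuous_Im f : continuous f -> continuous (fun x => complex.Im (f x)).
Proof.
move=> cf.
exact: (continuous_comp2 (continuous_comp2 cf continuous_ReIm) (@continuous_snd _ _)).
Qed.

Lemma continuousCM f g : continuous f -> continuous g ->
  continuous (fun x => f x * g x).
Proof.
move=> cf cg.
have [cfr cfi] := (continuous_Re cf, continuous_Im cf).
have [cgr cgi] := (continuous_Re cg, continuous_Im cg).
apply: continuousC => /= x.
- rewrite (_ : (fun y => _) = fun y => complex.Re (f y) * complex.Re (g y)
    - complex.Im (f y) * complex.Im (g y)); last first.
    by apply/funext => y; case: (f y) (g y) => [? ?] [].
  by apply: cvgB; apply: cvgM; [exact: cfr|exact: cgr|exact: cfi|exact: cgi].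
- rewrite (_ : (fun y => _) = fun y => complex.Re (f y) * complex.Im (g y)
    + complex.Im (f y) * complex.Re (g y)); last first.
    by apply/funext => y; case: (f y) (g y) => [? ?] [].
  by apply: cvgD; apply: cvgM; [exact: cfr|exact: cgi|exact: cfi|exact: cgr].
Qed.

Lemma continuousCD f g : continuous f -> continuous g ->
  continuous (fun x => f x + g x).
Proof.
move=> cf cg.
have [cfr cfi] := (continuous_Re cf, continuous_Im cf).
have [cgr cgi] := (continuous_Re cg, continuous_Im cg).
apply: continuousC => /= x.
- rewrite (_ : (fun y => _) = fun y => complex.Re (f y) + complex.Re (g y)); last first.
    by apply/funext => y; case: (f y) (g y) => [? ?] [].
  by apply: cvgD; [exact: cfr|exact: cgr].
- rewrite (_ : (fun y => _) = fun y => complex.Im (f y) + complex.Im (g y)); last first.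
    by apply/funext => y; case: (f y) (g y) => [? ?] [].
  by apply: cvgD; [exact: cfi|exact: cgi].
Qed.

Lemma continuous_real (u : S -> R) : continuous u -> continuous (fun x => (u x)%:C).
Proof. by move=> cu; apply: continuousC => //= x; exact: cvg_cst. Qed.

Lemma continuous_cis (u : S -> R) : continuous u -> continuous (fun x => cis (u x)).
Proof.
move=> cu; apply: continuousC => /=.
- exact: (continuous_comp2 cu (@continuous_cos R)).
- exact: (continuous_comp2 cu (@continuous_sin R)).
Qed.

Lemma continuous_nsq f : continuous f -> continuous (fun x => nsq (f x)).
Proof.
move=> cf; have [cr ci] := (continuous_Re cf, continuous_Im cf) => x.
by apply: cvgD; apply: cvgM; [exact: cr|exact: cr|exact: ci|exact: ci].
Qed.

End Continuity.

End ComplexPlane.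

(** * Twists of the disk *)

Section Twist.
Context {R : realType}.
Local Notation C := R[i].
Implicit Types (c s : R) (z : C).

(* The circle |z|^2 = c is fixed, and the unit circle is rotated by           *)
(* 4 pi s (c - 1) / 15: for c = 16 the outer boundary is fixed while the      *)
(* punctures turn by 4 pi s, and for c = 1 it is the other way round.         *)
Definition twist c s z : C := cis (4 * pi * s * ((c - nsq z) / 15)) * z.

Lemma nsq_twist c s z : nsq (twist c s z) = nsq z.
Proof. by rewrite nsqM nsq_cis mul1r. Qed.

(** The angle depends on [z] only through [nsq z], which the twist preserves, so the opposite twist
    turns back by the same angle. *)
Lemma twistK c s z : twist c (- s) (twist c s z) = z.
Proof.
rewrite /twist -/(twist c s z) nsq_twist /twist mulrA -cisD.
by rewrite mulrN mulNr addNr cis0 mul1r.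
Qed.

Lemma twistKV c s z : twist c s (twist c (- s) z) = z.
Proof. by have := twistK c (- s) z; rewrite opprK. Qed.

Lemma twist0 c z : twist c 0 z = z.
Proof. by rewrite /twist mulr0 mul0r cis0 mul1r. Qed.

Lemma twist_fixed c s z : nsq z = c -> twist c s z = z.
Proof. by move=> zc; rewrite /twist zc subrr mul0r mulr0 cis0 mul1r. Qed.

Lemma twist16_unit s z : nsq z = 1 -> twist 16 s z = cis (4 * pi * s) * z.
Proof. by move=> z1; rewrite /twist z1; congr (cis _ * _); field. Qed.

Lemma twist1_boundary s z : nsq z = 16 -> twist 1 s z = cis (- (4 * pi * s)) * z.
Proof. by move=> z1; rewrite /twist z1; congr (cis _ * _); field. Qed.

(** The two angles differ by [4 * pi] whatever [nsq z] is. Hence one diffeomorphism ends both the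
    isotopy fixing the boundary and the one fixing the punctures. *)
Lemma twist_1 z : twist 1 1 z = twist 16 1 z.
Proof.
rewrite /twist; set a := 4 * pi * 1 * ((16 - nsq z) / 15).
have -> : a = 4 * pi * 1 * ((1 - nsq z) / 15) + 4 * pi by rewrite /a; field.
by rewrite [in RHS]cisD cis4pi !mulr1.
Qed.

Lemma disk_twist c s z : disk z -> disk (twist c s z).
Proof. by move=> /diskP Dz; apply/diskP; rewrite nsq_twist. Qed.

Lemma continuous_twist c (S : topologicalType) (u : S -> R) (f : S -> C) :
  continuous u -> continuous f -> continuous (fun x => twist c (u x) (f x)).
Proof.
move=> cu cf; refine (continuousCM (continuous_cis _) cf) => x.
apply: cvgM; first by apply: cvgM; [exact: cvg_cst|exact: cu].
by apply: cvgM; [apply: cvgB; [exact: cvg_cst|exact: continuous_nsq]|exact: cvg_cst].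
Qed.

Lemma smooth_twist c s (A : set C) : smooth_on A (twist c s).
Proof.
move=> z _; pose X := @TVar R false; pose Y := @TVar R true.
pose N := TMul (TCst (-1)) (TAdd (TMul X X) (TMul Y Y)).
pose th := TMul (TCst (4 * pi * s)) (TMul (TAdd (TCst c) N) (TCst 15^-1)).
(* Real and imaginary parts of [cis th * (x +i* y)]. *)
exists setT, (teval (TAdd (TMul (TCos th) X) (TMul (TCst (-1)) (TMul (TSin th) Y)))),
  (teval (TAdd (TMul (TCos th) Y) (TMul (TSin th) X))).
split=> //; [exact: openT|exact: is_Coo_teval|exact: is_Coo_teval|].
move=> a b _ _ /=; rewrite /twist /cis /nsq /= !mulN1r -!expr2.
by simpc.
Qed.

Lemma diffeo_twist c s : diffeo disk (twist c s).
Proof.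
exists (twist c (- s)); split; first exact: smooth_twist.
- exact: smooth_twist.
- by move=> z Dz; split; exact: disk_twist.
- by move=> z _; exact: twistK.
- by move=> z _; exact: twistKV.
Qed.

End Twist.

(** * The motion of the fiber and the braid it induces *)

Section TangencyMotion.
Context {R : realType}.
Local Notation C := R[i].
Local Notation K := (@tangency_config R).
Implicit Types (s t : R) (y z : C).

Lemma tangency_fiberP (a : R) y :
  fiber (@tangency_curve R) (cis a) y <-> y = cis (a + a) \/ y = - cis (a + a).
Proof.
rewrite /fiber /tangency_curve /= cisD -expr2; split.
  case=> _ _ /eqP; rewrite mulf_eq0 addr_eq0 subr_eq0.
  by case/orP => /eqP; [right|left].
have n1 : nsq (cis a ^+ 2) = 1 by rewrite expr2 nsqM nsq_cis mulr1.
move=> h; split.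
- have -> : 1 = (1 : R)%:C :> C by [].
  by rewrite normc_le_real// nsq_cis expr1n.
- apply/diskP; have -> : nsq y = 1; last by lra.
  by case: h => ->; rewrite // -mulN1r nsqM n1 mulr1 /nsq /=; ring.
- by case: h => ->; rewrite ?addNr ?subrr ?(mulr0, mul0r).
Qed.

Lemma tangency_configP y : config_set K y <-> y = 1 \/ y = -1.
Proof. by have := tangency_fiberP 0 y; rewrite addr0 cis0. Qed.

Lemma nsq_tangency_config y : config_set K y -> nsq y = 1.
Proof. by case/tangency_configP => ->; rewrite /nsq /=; ring. Qed.

Lemma twist_tangency_config : twist 16 1 @` K = K.
Proof.
have tE y : config_set K y -> twist 16 1 y = y.
  by move=> /nsq_tangency_config/twist16_unit ->; rewrite mulr1 cis4pi mul1r.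
apply/seteqP; split => y; first by case=> k Kk <-; rewrite tE.
by move=> Ky; exists y => //; exact: tE.
Qed.

Lemma twist_disk_boundary s y : disk_boundary y -> twist 16 s y = y.
Proof. by move=> /disk_boundaryP; exact: twist_fixed. Qed.

Definition double_full_twist : disk_diffeo K :=
  DiskDiffeo (diffeo_twist 16 1) twist_tangency_config (@twist_disk_boundary 1).

Section Rotating.
Variables (n : nat) (m : 'I_n -> R -> C).
Hypothesis m_rot : forall i t, I01 t -> m i t = cis (4 * pi * t) * m i 0.

Lemma realizes_twist : [set m i 0 | i in [set: 'I_n]] = K -> realizes (twist 16) m.
Proof.
move=> mK; split.
- apply: continuous_subspaceT.
  exact: continuous_twist (@continuous_fst _ _) (@continuous_snd _ _).
- by move=> t _; exact: diffeo_twist.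
- by move=> t y _; exact: twist_disk_boundary.
- by move=> y _; exact: twist0.
- move=> i t It; rewrite (m_rot i It) twist16_unit//; apply: nsq_tangency_config.
  by rewrite -mK; exists i.
Qed.

(* With d the given realization and T the twist, T_s^-1 o d_s fixes the       *)
(* punctures throughout, so T_1 o T_s^-1 o d_s deforms T_1 into d_1.          *)
Lemma braid_of_rotation (b : braid K) :
  induced_by_motion m b -> b = braid_class double_full_twist.
Proof.
case=> -[_ mD _ mK _] [d [f [[cd dD db d0 dm] fE ->]]].
apply/eqmodP/asboolP => a; elim/quotW: a => g.
rewrite /dd_pi1 !pi1_mapE; apply/eq_pi1/homotopic_sym.
have IgD t : I01 t -> disk (g t) by move=> /(loop_in g) [].
exists (fun z : R * R => twist 16 1 (twist 16 (- z.1) (d z.1 (g z.2)))); split.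
(* [d] is continuous only on [I01] times the disk, so the homotopy is composed in three stages, each
   with its own domain. *)
- have c1 : {within I01 `*` I01, continuous (fun z : R * R => (z.1, g z.2))}.
    apply: (within_continuousE (f := fun z : R * R => (z.1, (g \o clamp) z.2))).
      by move=> z [_ /= I2]; rewrite clamp_id.
    apply: continuous_subspaceT.
    apply: continuous_pair; first exact: continuous_fst.
    exact: continuous_comp2 (@continuous_snd _ _) (@loop_ext _ _ _ g).
  have c2 : {within I01 `*` disk, continuous (fun w : R * C => (w.1, d w.1 w.2))}.
    apply/subspace_continuousP => w Iw.
    apply: (@cvg_pair _ _ _ _ (nbhs w.1) (nbhs (d w.1 w.2))).
      by apply: cvg_within_filter; exact: cvg_fst.
    by move/subspace_continuousP: cd; exact.
  have c3 : {within setT,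
      continuous (fun w : R * C => twist 16 1 (twist 16 (- w.1) w.2))}.
    apply: continuous_subspaceT.
    apply: continuous_twist; first by move=> w; exact: cvg_cst.
    apply: continuous_twist; last exact: continuous_snd.
    by move=> w; apply: cvgN; exact: cvg_fst.
  apply: (Defs.within_continuous_comp (Defs.within_continuous_comp c1 c2 _) c3).
    move=> z [/= I1 I2].
    by split=> //; exact: IgD.
  by [].
- move=> s t Is It /=; apply: (dd_in double_full_twist); split.
    by apply: disk_twist; case: (dD s Is) => ? [_ _ h _ _]; have [] := h _ (IgD t It).
  (* If the untwisted point were the puncture [m i 0], then [d s (g t)] would be [m i s], that is
     [d s (m i 0)]; injectivity of [d s] would put [g t] on a puncture. *)
  move=> Kw; have [_ []] := loop_in g It.
  have := Kw; rewrite -{1}mK => -[i _ iE].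
  have dE : d s (g t) = d s (m i 0).
    rewrite dm// (m_rot i Is) -[LHS](twistKV 16 s) iE twist16_unit//.
    exact: nsq_tangency_config.
  case: (dD s Is) => h [_ _ _ hK _].
  rewrite -(hK _ (IgD _ It)) dE hK; last by apply: mD; exact: I01_0.
  by rewrite -mK; exists i.
- by move=> t It /=; rewrite oppr0 d0 ?twist0//; exact: IgD.
- by move=> t It /=; rewrite twistKV fE//; exact: IgD.
- move=> s Is /=; rewrite loop_0 loop_1 /=.
  by rewrite db ?twist_disk_boundary//; exact: base_pt_boundary.
Qed.

End Rotating.

(** Rotated back by [4 * pi * t], a strand is continuous with values in [{1, -1}], hence
    constant. *)
Lemma fiber_motion_rotates n (m : 'I_n -> R -> C) :
  (forall i, {within I01, continuous (m i)}) ->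
  (forall t, I01 t ->
    [set m i t | i in [set: 'I_n]] = fiber (@tangency_curve R) (cis (2 * pi * t))) ->
  forall i t, I01 t -> m i t = cis (4 * pi * t) * m i 0.
Proof.
move=> cm mE i t It.
(* The rotated point is [1] or [-1], so its real part loses nothing and allows the intermediate
   value theorem; [clamp] makes [g] continuous on all of [R]. *)
pose g s := complex.Re (cis (- (4 * pi * s)) * m i (clamp s)).
have gE s : I01 s -> m i s = (g s)%:C * cis (4 * pi * s) /\ (g s = 1 \/ g s = -1).
  move=> Is; have : fiber (@tangency_curve R) (cis (2 * pi * s)) (m i s).
    by rewrite -mE//; exists i.
  case/tangency_fiberP; have -> : 2 * pi * s + 2 * pi * s = 4 * pi * s by ring.
  - by move=> e; rewrite /g clamp_id// e cisK /= mul1r; split=> //; left.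
  - by move=> e; rewrite /g clamp_id// e mulrN cisK raddfN /= mulN1r; split=> //; right.
have cg : continuous g.
  apply: continuous_Re; apply: continuousCM.
    apply: continuous_cis => s; apply: cvgN; apply: cvgM; first exact: cvg_cst.
    exact: cvg_id.
  apply/continuous_subspace_setT.
  apply: Defs.within_continuous_comp (cm i) _ => [|s _]; last exact: clamp_in.
  by apply: continuous_subspaceT; exact: continuous_clamp.
suff gt : g t = g 0.
  have [-> _] := gE t It; have [-> _] := gE 0 I01_0.
  by rewrite gt mulr0 cis0 mulr1 mulrC.
apply: contrapT => ne; have /I01P/andP[t0 t1] := It.
(* If [g 0] and [g t] differ they are [1] and [-1], and [g] would vanish in between. *)
have [|c] := @IVT R g 0 t 0 t0 (continuous_subspaceT cg).
  rewrite ge_min le_max.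
  have [_ [] gt] := gE t It; have [_ [] g0] := gE 0 I01_0; rewrite gt g0 in ne *;
    by [case: ne|rewrite ?ler01 ?oppr_le0 ?ler01 ?orbT].
rewrite in_itv /= => /andP[c0 ct] gc.
have /gE[_] : I01 c by apply/I01P; rewrite c0 (le_trans ct).
by rewrite gc; case=> h; lra.
Qed.

Lemma is_motion_rotation :
  is_motion K (rotation_motion (fun i : 'I_2 => (-1 : C) ^+ i) (4 * pi)).
Proof.
have nE (i : 'I_2) : nsq ((-1 : C) ^+ i) = 1.
  by case: i => -[|[|//]] ? /=; rewrite ?expr0 ?expr1 /nsq /=; ring.
have KE (a : C) : a = 1 -> [set a * (-1) ^+ (i : 'I_2) | i in [set: 'I_2]] = K.
  move=> ->; apply/seteqP; split=> y.
    case=> i _ <-; apply/tangency_configP; rewrite mul1r.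
    by case: i => -[|[|//]] ? /=; [left|right].
  by case/tangency_configP => ->; [exists ord0|exists ord_max] => //=; rewrite mul1r.
split.
- move=> i; apply: continuous_subspaceT; apply: continuousCM; last by move=> t; exact: cvg_cst.
  by apply: continuous_cis => t; apply: cvgM; [exact: cvg_cst|exact: cvg_id].
- by move=> i t _; apply/diskP; rewrite nsqM nsq_cis nE; lra.
- move=> i j t _ ij e; have := congr1 (fun z => cis (- (4 * pi * t)) * z) e.
  rewrite /rotation_motion !mulrA cisK !mul1r.
  case: i j ij {e} => -[|[|//]] ? [[|[|//]]] ? //= _ /eqP;
    rewrite ?expr0 ?expr1 ?eq_complex /= => /andP[/eqP]; lra.
- by apply: KE; rewrite mulr0 cis0.
- by apply: KE; rewrite mulr1 cis4pi.
Qed.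

Lemma rotation_fiber t :
  [set rotation_motion (fun i : 'I_2 => (-1 : C) ^+ i) (4 * pi) i t | i in [set: 'I_2]] =
  fiber (@tangency_curve R) (cis (2 * pi * t)).
Proof.
have e : 2 * pi * t + 2 * pi * t = 4 * pi * t by ring.
apply/seteqP; split=> y.
  case=> i _ <-; apply/tangency_fiberP; rewrite e /rotation_motion.
  by case: i => -[|[|//]] ? /=; rewrite ?expr0 ?expr1 ?mulr1 ?mulrN1; [left|right].
case/tangency_fiberP => ->; rewrite e /rotation_motion.
  by exists ord0 => //=; rewrite expr0 mulr1.
by exists ord_max => //=; rewrite expr1 mulrN1.
Qed.

Lemma rotation_motion_double_full_twist :
  induced_by_motion (rotation_motion (fun i : 'I_2 => (-1 : C) ^+ i) (4 * pi))
    (braid_class double_full_twist).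
Proof.
have M := is_motion_rotation; split=> //.
exists (twist 16), double_full_twist; split=> //; apply: realizes_twist.
  by move=> i t _; rewrite /rotation_motion mulr0 cis0 mul1r.
by case: M.
Qed.

(** Any labelled motion tracing the fibers is a rigid rotation, and [braid_of_rotation] determines
    its braid; the explicit rotation of [1] and [-1] gives existence. *)
Lemma tangency_braid_monodromy (b : braid K) :
  local_braid_monodromy (@tangency_curve R) b <-> b = braid_class double_full_twist.
Proof.
split=> [[n [m [mE mb]]]|->]; last first.
  exists 2%N, (rotation_motion (fun i : 'I_2 => (-1 : C) ^+ i) (4 * pi)).
  by split=> [t _|]; [exact: rotation_fiber|exact: rotation_motion_double_full_twist].
apply: (braid_of_rotation _ mb).
by apply: fiber_motion_rotates => //; case: mb => -[].
Qed.

End TangencyMotion.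

(** * Free homotopies with a moving base point *)

Section FreeHomotopy.
Context {R : realType} {T : topologicalType} (X : pset T).

(* A free homotopy whose base point runs along d reads on the boundary of the *)
(* square I01 x I01 as f.d = d.g.                                             *)
Lemma homotopic_free (H : R * R -> T) (f g d : loop R X) :
  {within I01 `*` I01, continuous H} ->
  (forall s t, I01 s -> I01 t -> pset_car X (H (s, t))) ->
  (forall t, I01 t -> H (0, t) = f t) -> (forall t, I01 t -> H (1, t) = g t) ->
  (forall s, I01 s -> H (s, 0) = d s /\ H (s, 1) = d s) ->
  homotopic (cat_loop f d) (cat_loop d g).
Proof.
move=> cH HX H0 H1 He.
(* The path [(a, b)] follows two sides of the square and reads [f] then [d] through [H]; [(b, a)]
   follows the other two and reads [d] then [g]. Interpolation by [mid] joins them with the corners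
   [(0, 0)] and [(1, 1)] fixed. *)
pose a (t : R) : R := clamp (2 * t - 1); pose b (t : R) : R := clamp (2 * t).
have ca : continuous a := continuous_comp2 continuous_dblB1 continuous_clamp.
have cb : continuous b := continuous_comp2 continuous_dbl continuous_clamp.
pose mid (u v : R -> R) (z : R * R) := (1 - z.1) * u z.2 + z.1 * v z.2.
have cmid u v : continuous u -> continuous v -> continuous (mid u v).
  move=> cu cv z; apply: cvgD; apply: cvgM.
  - by apply: cvgB; [exact: cvg_cst|exact: cvg_fst].
  - exact: (continuous_comp2 (@continuous_snd _ _) cu).
  - exact: cvg_fst.
  - exact: (continuous_comp2 (@continuous_snd _ _) cv).
have [aE bE] : (forall t, t <= 2^-1 -> a t = 0) /\
    (forall t, (t <= 2^-1) = false -> b t = 1).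
  split=> t; first by move=> th; rewrite /a /clamp max_l ?min_r//; lra.
  by move/negbT; rewrite -ltNge => th; rewrite /b /clamp min_l// le_max; apply/orP; right; lra.
have aE' t : I01 t -> (t <= 2^-1) = false -> a t = 2 * t - 1.
  by move=> It th; rewrite /a clamp_id//; exact: I01_half2.
have bE' t : I01 t -> t <= 2^-1 -> b t = 2 * t.
  by move=> It th; rewrite /b clamp_id//; exact: I01_half1.
pose H' (z : R * R) := H (clamp z.1, clamp z.2).
have cH' : continuous H' := homotopy_ext cH.
have H'E s t : I01 s -> I01 t -> H' (s, t) = H (s, t).
  by move=> Is It; rewrite /H' /= !clamp_id.
have aI t : I01 (a t) := clamp_in _.
have bI t : I01 (b t) := clamp_in _.
exists (fun z => H' (mid a b z, mid b a z)); split.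
- apply: continuous_subspaceT.
  exact: continuous_comp2 (continuous_pair (cmid a b ca cb) (cmid b a cb ca)) cH'.
- by move=> s t _ _; exact: (HX _ _ (clamp_in _) (clamp_in _)).
- move=> t It; rewrite /mid /= subr0 !mul1r !mul0r !addr0 H'E// /cat_fun.
  case: ifPn => [th|/negbTE th].
  + by rewrite aE// H0// bE'.
  + by rewrite bE// (He _ (aI t)).2 aE'.
- move=> t It; rewrite /mid /= subrr !mul1r !mul0r !add0r H'E// /cat_fun.
  case: ifPn => [th|/negbTE th].
  + by rewrite aE// (He _ (bI t)).1 bE'.
  + by rewrite bE// H1// aE'.
- move=> s _; have [a0 b0] : a 0 = 0 /\ b 0 = 0.
    have h0 : (0 : R) <= 2^-1 by rewrite invr_ge0 ler0n.
    by rewrite (aE _ h0) (bE' _ I01_0 h0) mulr0.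
  have [a1 b1] : a 1 = 1 /\ b 1 = 1.
    by rewrite (bE _ half_le1) (aE' _ I01_1 half_le1) two_sub1.
  rewrite /mid /= a0 b0 a1 b1 !mulr0 !addr0 !mulr1 !subrK !H'E//; last first.
  - exact: I01_0.
  - exact: I01_0.
  - exact: I01_1.
  - exact: I01_1.
  by rewrite (He _ I01_0).1 (He _ I01_1).2 loop_0 loop_1.
Qed.

End FreeHomotopy.

(** * The double full twist acts as a conjugation *)

Section FullTwist.
Context {R : realType}.
Local Notation C := R[i].
Local Notation K := (@tangency_config R).
Local Notation X := (punctured_disk K).
Local Open Scope quotient_scope.

Lemma nsq_base_pt : nsq (base_pt : C) = 16.
Proof. exact/disk_boundaryP/base_pt_boundary. Qed.

Lemma punctured_boundary (y : C) : nsq y = 16 -> pset_car X y.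
Proof.
move=> y16; split; first by apply/diskP; rewrite y16.
by move=> /nsq_tangency_config; rewrite y16 => ?; lra.
Qed.

Lemma boundary_loop_cts :
  {within I01, continuous (fun t : R => cis (2 * pi * t) * base_pt)}.
Proof.
apply: continuous_subspaceT; apply: continuousCM; last by move=> t; exact: cvg_cst.
by apply: continuous_cis => t; apply: cvgM; [exact: cvg_cst|exact: cvg_id].
Qed.

Lemma boundary_loop_in (t : R) : I01 t -> pset_car X (cis (2 * pi * t) * base_pt).
Proof. by move=> _; apply: punctured_boundary; rewrite nsqM nsq_cis nsq_base_pt mul1r. Qed.

Lemma boundary_loop_0 : cis (2 * pi * 0) * base_pt = pset_pt X.
Proof. by rewrite mulr0 cis0 mul1r. Qed.

Lemma boundary_loop_1 : cis (2 * pi * 1) * base_pt = pset_pt X.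
Proof. by rewrite mulr1 cis2pi mul1r. Qed.

Definition boundary_loop : loop R X :=
  Loop boundary_loop_cts boundary_loop_in boundary_loop_0 boundary_loop_1.

(* twist 1 fixes the punctures and turns the boundary twice clockwise.        *)
Lemma double_full_twist_homotopic (g : loop R X) :
  let d := cat_loop (rev_loop boundary_loop) (rev_loop boundary_loop) in
  homotopic (cat_loop g d) (cat_loop d (map_loop (dd_pmap double_full_twist) g)).
Proof.
move=> d; apply: (@homotopic_free _ _ _ (fun z : R * R => twist 1 z.1 (g z.2))).
- apply: (within_continuousE (f := fun z : R * R => twist 1 z.1 ((g \o clamp) z.2))).
    by move=> z [_ /= I2]; rewrite clamp_id.
  apply: continuous_subspaceT; apply: continuous_twist; first exact: continuous_fst.
  exact: continuous_comp2 (@continuous_snd _ _) (@loop_ext _ _ _ g).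
- move=> s t Is /(loop_in g)[Dg nKg] /=; split; first exact: disk_twist.
  move=> Kg; apply: nKg; rewrite -[g t](twistK 1 s) twist_fixed//.
  exact: nsq_tangency_config.
- by move=> t It /=; rewrite twist0.
- by move=> t It /=; rewrite twist_1.
- move=> s Is /=; rewrite loop_0 loop_1 /= twist1_boundary ?nsq_base_pt//.
  (* The base point is at angle [- (4 * pi * s)] from its start; the two halves of [d] give this
     angle up to [2 * pi] and [4 * pi]. *)
  suff -> : cat_fun (fun t => cis (2 * pi * (1 - t)) * base_pt)
     (fun t => cis (2 * pi * (1 - t)) * base_pt) s = cis (- (4 * pi * s)) * base_pt by [].
  rewrite /cat_fun; case: ifP => _; congr (_ * _).
    have -> : 2 * pi * (1 - 2 * s) = 2 * pi + - (4 * pi * s) by ring.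
    by rewrite cisD cis2pi mul1r.
  have -> : 2 * pi * (1 - (2 * s - 1)) = 4 * pi + - (4 * pi * s) by ring.
  by rewrite cisD cis4pi mul1r.
Qed.

(** With [c] the class of the boundary loop, the preceding homotopy reads
    [a * c ^- 2 = c ^- 2 * T a], where [T] is the action of the twist. *)
Lemma double_full_twist_conj (a : pi1 R X) :
  dd_pi1 double_full_twist a = (a ^ (\pi_(pi1 R X) boundary_loop ^- 2))%g.
Proof.
elim/quotW: a => g; rewrite /dd_pi1 pi1_mapE.
set c := \pi_(pi1 R X) boundary_loop.
have /eq_pi1 := double_full_twist_homotopic g.
rewrite -!pi1_mulE -!pi1_invE -/c => e.
have {}e : (\pi_(pi1 R X) g * (c^-1 * c^-1) = c^-1 * c^-1 *
  \pi_(pi1 R X) (map_loop (dd_pmap double_full_twist) g))%g by exact: e.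
have -> : (c ^- 2 = c^-1 * c^-1)%g by rewrite expgS expg1 invgM.
by rewrite /conjg e mulKg.
Qed.

End FullTwist.

(** * Reparametrizations and straight-line homotopies *)

Section Reparametrization.
Context {R : realType} {T : topologicalType} (X : pset T).

Lemma loop_reparam (l : loop R X) (p : R -> R) : continuous p ->
  (forall t, I01 t -> I01 (p t)) -> p 0 = 0 -> p 1 = 1 ->
  exists2 f : loop R X, (forall t, f t = l (p t)) & homotopic f l.
Proof.
move=> cp pI p0 p1.
have lc : {within I01, continuous (fun t => l (p t))}.
  apply: (Defs.within_continuous_comp (continuous_subspaceT cp) (@loop_cts _ _ _ l)).
  exact: pI.
have lI t : I01 t -> pset_car X (l (p t)) by move=> It; exact/loop_in/pI.
have l0 : l (p 0) = pset_pt X by rewrite p0 loop_0.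
have l1 : l (p 1) = pset_pt X by rewrite p1 loop_1.
exists (Loop lc lI l0 l1) => //.
by apply: (@homotopic_reparam _ _ _ l _ _ p id) => // t; exact: cvg_id.
Qed.

End Reparametrization.

Section LineHomotopy.
Context {R : realType}.
Local Notation C := R[i].
Variable K : @config R.
Local Notation X := (punctured_disk K).

Lemma disk_convex (s : R) (y z : C) : I01 s -> disk y -> disk z ->
  disk ((1 - s)%:C * y + s%:C * z).
Proof.
case: y z => [a b] [c d] /I01P/andP[s0 s1] /diskP hy /diskP hz; apply/diskP.
move: hy hz; rewrite /nsq /=; simpc => hy hz.
(* This is exactly the amount by which the convex combination of the squared moduli exceeds the
   squared modulus of the combination. *)
have h : 0 <= s * (1 - s) * ((a - c) ^+ 2 + (b - d) ^+ 2).
  by rewrite mulr_ge0 ?addr_ge0 ?sqr_ge0// mulr_ge0// subr_ge0.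
have hy' := ler_wpM2l (_ : 0 <= 1 - s) hy; have hz' := ler_wpM2l s0 hz.
have {}hy' := hy' ltac:(lra).
nra.
Qed.

(** The disk being convex, only the punctures can obstruct the segments from [f t] to [g t]. *)
Lemma homotopic_line (f g : loop R X) :
  (forall s t, I01 s -> I01 t ->
    ~ config_set K ((1 - s)%:C * f t + s%:C * g t)) ->
  homotopic f g.
Proof.
move=> nK; exists (fun z : R * R => (1 - z.1)%:C * f z.2 + z.1%:C * g z.2); split.
- apply: (within_continuousE (f := fun z : R * R =>
    (1 - z.1)%:C * (f \o clamp) z.2 + z.1%:C * (g \o clamp) z.2)).
    by move=> z [_ /= I2]; rewrite clamp_id.
  apply: continuous_subspaceT; apply: continuousCD; apply: continuousCM.
  + apply: continuous_real => z; apply: cvgB; [exact: cvg_cst|exact: cvg_fst].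
  + exact: continuous_comp2 (@continuous_snd _ _) (@loop_ext _ _ _ f).
  + by apply: continuous_real; exact: continuous_fst.
  + exact: continuous_comp2 (@continuous_snd _ _) (@loop_ext _ _ _ g).
- move=> s t Is It; split; last exact: nK.
  by apply: disk_convex => //; [have [] := loop_in f It|have [] := loop_in g It].
- by move=> t _ /=; rewrite subr0 mul1r mul0r addr0.
- by move=> t _ /=; rewrite subrr mul1r mul0r add0r.
- move=> s _ /=; rewrite !loop_0 !loop_1 -!mulrDl -rmorphD subrK.
  by rewrite rmorph1 mul1r.
Qed.

End LineHomotopy.

(** * The boundary loop is the product of the two lassos *)

Section BoundaryProduct.
Context {R : realType}.
Local Notation C := R[i].
Local Notation K := (@tangency_config R).
Local Notation X := (punctured_disk K).
Local Open Scope quotient_scope.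
Implicit Types (p e s t : R).

(** One polar form about [p] covers the three phases: [clamp] freezes the angle at no turn or one
    full turn on the straight parts, where only [l] varies. The last bound keeps the lasso in a
    half-plane that excludes the other puncture [- p]. *)
Lemma lasso_polar p e t : p = 1 \/ p = -1 -> 0 < e < 2 -> I01 t ->
  exists l : R, [/\ 0 < l,
    lasso base_pt p%:C e t =
      p%:C + l%:C * cis (2 * pi * clamp (3 * t - 1)) * (base_pt - p%:C)
    & -1 < p * complex.Re (lasso base_pt p%:C e t)].
Proof.
move=> hp e02 /I01P t01; have p2 : p ^+ 2 = 1 by case: hp => ->; ring.
(* [r] is the distance from the base point to either puncture, and [k] below the fraction of it at
   which the small circle begins. *)
set r : R := Num.sqrt 17; have r0 : 0 < r by rewrite sqrtr_gt0.
have rr : r ^+ 2 = 17 by rewrite sqr_sqrtr.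
have vE : base_pt - p%:C = - p -i* 4 by rewrite /base_pt; simpc.
have nE : `|base_pt - p%:C| = r%:C.
  by rewrite vE normc_def /= !sqrrN p2; congr ((Num.sqrt _)%:C); ring.
pose k := e / r; have k0 : 0 < k by rewrite divr_gt0//; lra.
have ek : e = k * r by rewrite /k divfK// gt_eqF.
have k2 : k ^+ 2 * 17 < 4 by rewrite -rr -exprMn -ek; nra.
have k1 : k < 1 by nra.
have qE : e%:C / `|base_pt - p%:C| = k%:C by rewrite nE /k rmorphM fmorphV.
rewrite /lasso qE; set v := base_pt - p%:C in vE *.
have reE (l : R) (w : C) : p * complex.Re (p%:C + l%:C * w * v) =
    1 + l * (- complex.Re w + 4 * (p * complex.Im w)).
  by rewrite vE; case: w => a b; simpc; rewrite /=; rewrite -[in RHS]p2; nra.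
have uE : base_pt = p%:C + v by rewrite /v addrCA subrr addr0.
case: ifPn => [t1|t1].
- exists (1 - 3 * t * (1 - k)).
  have l0 : 0 < 1 - 3 * t * (1 - k) <= 1 by nra.
  have cE : clamp (3 * t - 1) = 0 by rewrite /clamp max_l ?min_r//; lra.
  have E : base_pt + (3 * t)%:C * (p%:C + k%:C * v - base_pt) =
      p%:C + (1 - 3 * t * (1 - k))%:C * 1 * v.
    rewrite uE !(rmorphB, rmorphM, rmorph1) /=; ring.
  rewrite cE mulr0 cis0 E; split=> //; first by case/andP: l0.
  rewrite reE /=; lra.
case: ifPn => [t2|t2].
- exists k; have -> : clamp (3 * t - 1) = 3 * t - 1.
    by rewrite clamp_id//; apply/I01P; lra.
  set w := cis _; have E : p%:C + w * (p%:C + k%:C * v - p%:C) = p%:C + k%:C * w * v by ring.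
  rewrite E; split=> //; rewrite reE.
  have := nsq_cis (2 * pi * (3 * t - 1)); rewrite -/w /nsq.
  set a := complex.Re w; set b := complex.Im w => ab.
  (* Cauchy-Schwarz: this square and that of [4 * a + p * b] add up to [17 * (a ^+ 2 + b ^+ 2)]. *)
  have h : (- a + 4 * (p * b)) ^+ 2 <= 17.
    have := sqr_ge0 (4 * a + p * b); rewrite -[17]mulr1 -ab => h.
    have pb : (p * b) ^+ 2 = b ^+ 2 by rewrite exprMn p2 mul1r.
    nra.
  have : (k * (- a + 4 * (p * b))) ^+ 2 < 4.
    by rewrite exprMn (le_lt_trans _ k2)// ler_wpM2l// sqr_ge0.
  set d := k * _ => d4; nra.
- exists (k + (3 * t - 2) * (1 - k)).
  have l0 : 0 < k + (3 * t - 2) * (1 - k) <= 1 by nra.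
  have -> : clamp (3 * t - 1) = 1.
    by rewrite /clamp min_l// le_max; apply/orP; right; lra.
  have E : p%:C + k%:C * v + (3 * t - 2)%:C * (base_pt - (p%:C + k%:C * v)) =
      p%:C + (k + (3 * t - 2) * (1 - k))%:C * 1 * v.
    rewrite uE !(rmorphD, rmorphN, rmorphM, rmorph1) /=; ring.
  rewrite mulr1 cis2pi E; split=> //; first by case/andP: l0.
  rewrite reE /=; lra.
Qed.

(** While the lasso circles [p], the other end of the segment makes the half-turn of the boundary on
    the side of [p], at half the angular speed. *)
Lemma lasso_avoid p e s t : p = 1 \/ p = -1 -> 0 < e < 2 -> I01 s -> I01 t ->
  ~ config_set K ((1 - s)%:C * lasso base_pt p%:C e t +
      s%:C * (p%:C * cis (pi * clamp (3 * t - 1)) * base_pt)).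
Proof.
move=> hp e02 Is It; have [l [l0 lE lb]] := lasso_polar hp e02 It.
have p2 : p ^+ 2 = 1 by case: hp => ->; ring.
set u := clamp (3 * t - 1) in lE *.
have y0 : 0 <= sin (pi * u).
  have /I01P/andP[u0 u1] : I01 u := clamp_in _.
  by apply: sin_ge0_pi; rewrite mulr_ge0 ?pi_ge0//= ler_piMr// pi_ge0.
have xy := cos2Dsin2 (pi * u); move: lE lb.
have -> : cis (2 * pi * u) = cis (pi * u) * cis (pi * u).
  by rewrite -cisD; congr cis; ring.
rewrite /cis; set x := cos _ in xy *; set y := sin _ in xy y0 *.
move=> lE lb /tangency_configP kE.
have {kE} [] : (1 - s)%:C * lasso base_pt p%:C e t +
      s%:C * (p%:C * (x +i* y) * base_pt) = p%:C \/
    (1 - s)%:C * lasso base_pt p%:C e t +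
      s%:C * (p%:C * (x +i* y) * base_pt) = (- p)%:C.
- by case: hp kE => ->; case=> ->; [left|right|right|left]; rewrite ?opprK ?rmorphN ?rmorph1.
- (* Multiplying by the conjugate of c makes the equation affine in (x, y).   *)
  pose c : C := x +i* y; pose c' : C := x -i* y.
  have cc : c' * c = 1.
    by rewrite /c' /c; simpc; rewrite -!expr2 xy; congr (_ +i* _); ring.
  move=> /(congr1 (fun z => c' * (z - p%:C))); rewrite lE -/c.
  rewrite (_ : c' * _ = (1 - s)%:C * l%:C * (c' * c) * c * (base_pt - p%:C) +
    s%:C * p%:C * ((c' * c) * base_pt - c')); last by rewrite rmorphB rmorph1; ring.
  rewrite cc subrr mulr0 /c /c' /base_pt; simpc.
  have k0 : 0 <= (1 - s) * l by have /I01P := Is; nra.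
  have ks : 0 < (1 - s) * l + s by have /I01P := Is; nra.
  move=> [] /eqP; set k := (1 - s) * l in k0 ks *; set X := p * x => h1 h2.
  have {}h1 : (k + s) * X = 4 * (k * y) by rewrite /X; move/eqP: h1 => h1; lra.
  have {h2} : 4 * (k * X) + k * y + s * (4 - y) = 0.
    by rewrite /X; case: hp => pE; rewrite pE in h2 *; lra.
  (* The real part forces [X] to be nonnegative; the imaginary part is then a vanishing sum of
     nonnegative terms, so [s], [X] and [y] all vanish, against [x ^+ 2 + y ^+ 2 = 1]. *)
  have X0 : 0 <= X.
    by rewrite -(pmulr_rge0 _ ks) h1 mulr_ge0// mulr_ge0.
  have y1 : y <= 1 by nra.
  have kX0 := mulr_ge0 k0 X0; have ky0 := mulr_ge0 k0 y0.
  have s0 : 0 <= s by have /I01P/andP[] := Is.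
  have sy0 : 0 <= s * (4 - y) by rewrite mulr_ge0//; lra.
  move=> h2; have {}s0 : s = 0 by nra.
  have [kX ky] : k * X = 0 /\ k * y = 0 by lra.
  have {}k0 : k != 0 by rewrite gt_eqF//; lra.
  move/eqP: kX; rewrite mulf_eq0 (negbTE k0) /= => /eqP X00.
  move/eqP: ky; rewrite mulf_eq0 (negbTE k0) /= => /eqP y00.
  have : X ^+ 2 = x ^+ 2 by rewrite exprMn p2 mul1r.
  by rewrite X00 => x00; move: xy; rewrite -x00 y00; lra.
(* For the puncture [- p]: [p] times the real part exceeds [-1] at both ends of the segment, the
   boundary end giving [4 * y]. *)
- move=> /(congr1 (fun z => p * complex.Re z)).
  have -> : p * complex.Re ((1 - s)%:C * lasso base_pt p%:C e t +
      s%:C * (p%:C * (x +i* y) * base_pt)) =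
      (1 - s) * (p * complex.Re (lasso base_pt p%:C e t)) + s * (4 * y * p ^+ 2).
    by case: (lasso _ _ _ _) => a b; rewrite /base_pt; simpc => /=; ring.
  rewrite /= mulrN -expr2 p2 => h; have /I01P s01 := Is.
  have [s1|s1] : s < 1 \/ s = 1 by case: ltgtP => //; lra.
    have := mulr_gt0 (_ : 0 < 1 - s) (_ : 0 < p * complex.Re (lasso base_pt p%:C e t) + 1).
    by move=> /(_ ltac:(lra) ltac:(lra)); nra.
  by rewrite s1 in h; lra.
Qed.

Lemma lasso_product_boundary (e1 e2 : R) (l1 l2 : loop R X) :
  0 < e1 < 2 -> 0 < e2 < 2 ->
  (forall t, I01 t -> l1 t = lasso base_pt (-1)%:C e1 t) ->
  (forall t, I01 t -> l2 t = lasso base_pt 1%:C e2 t) ->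
  homotopic (cat_loop l2 l1) (boundary_loop (R := R)).
Proof.
move=> e12 e22 l1E l2E.
(* The boundary loop is slowed to stand still while a lasso runs along its segment, and to make half
   a turn while the lasso circles. The arguments are [3 * u - 1] at the lasso times [u = 2 * t] and
   [u = 2 * t - 1]. *)
pose phi t : R := 2^-1 * clamp (6 * t + - 1) + 2^-1 * clamp (6 * t + - 4).
have cphi : continuous phi.
  move=> t; apply: cvgD; apply: cvgM; try exact: cvg_cst.
    exact: (continuous_comp2 (@continuous_affine _ 6 (- 1)) continuous_clamp).
  exact: (continuous_comp2 (@continuous_affine _ 6 (- 4)) continuous_clamp).
have phi1 t : t <= 2^-1 -> phi t = 2^-1 * clamp (3 * (2 * t) - 1).
  move=> th; rewrite /phi [X in _ + _ * X](_ : _ = 0); last first.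
    by rewrite /clamp max_l ?min_r//; lra.
  by rewrite mulr0 addr0; congr (_ * clamp _); ring.
have phi2 t : (t <= 2^-1) = false -> phi t = 2^-1 + 2^-1 * clamp (3 * (2 * t - 1) - 1).
  move/negbT; rewrite -ltNge => th; rewrite /phi [clamp (_ + - 1)](_ : _ = 1); last first.
    by rewrite /clamp min_l// le_max; apply/orP; right; lra.
  by rewrite mulr1; congr (_ + _ * clamp _); ring.
have [|||f fE fb] := @loop_reparam _ _ _ (boundary_loop (R := R)) phi cphi.
- move=> t _; apply/I01P; rewrite /phi.
  have /I01P := clamp_in (6 * t + - 1); have /I01P := clamp_in (6 * t + - 4); lra.
- rewrite phi1 ?invr_ge0 ?ler0n// /clamp max_l ?min_r ?mulr0//; lra.
- by rewrite phi2 ?half_le1// /clamp min_l; [lra|rewrite le_max; apply/orP; right; lra].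
apply: homotopic_trans fb; apply: homotopic_line => s t Is It.
rewrite fE /= /cat_fun; case: ifPn => [th|/negbTE th].
- have It2 := I01_half1 It th; rewrite l2E// phi1//.
  have := lasso_avoid (or_introl erefl) e22 Is It2; rewrite mul1r.
  by rewrite -(_ : 2 * pi * (2^-1 * clamp (3 * (2 * t) - 1)) = pi * clamp (3 * (2 * t) - 1));
    last by field.
- have It2 := I01_half2 It th; rewrite l1E// phi2//.
  have := lasso_avoid (or_intror erefl) e12 Is It2.
  rewrite (_ : (-1)%:C * cis _ = cis (2 * pi * (2^-1 + 2^-1 * clamp (3 * (2 * t - 1) - 1))))//.
  by rewrite rmorphN rmorph1 -cispi -cisD; congr cis; field.
Qed.

(** The other puncture lies at distance 2 from [p]. *)
Lemma lasso_radius p e : p = 1 \/ p = -1 -> 0 < e ->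
  (forall y : C, `|y - p%:C| <= e%:C ->
     disk y /\ (config_set K y -> y = p%:C)) -> e < 2.
Proof.
move=> hp e0 he; rewrite ltNge; apply/negP => e2.
have p2 : p ^+ 2 = 1 by case: hp => ->; ring.
have [|_] := he (- p)%:C.
  rewrite (normc_le_real _ (ltW e0)); have -> : nsq ((- p)%:C - p%:C) = 4 * p ^+ 2.
    by rewrite /nsq /=; ring.
  by rewrite p2; nra.
have Kp : config_set K (- p)%:C.
  by apply/tangency_configP; case: hp => ->; [right|left];
    rewrite ?opprK ?rmorphN ?rmorph1.
by move=> /(_ Kp) /complexI; case: hp => ->; lra.
Qed.

(** The ordering puts [x ord0] around [-1] and [x ord_max] around [1]. Counterclockwise from [-4i]
    the boundary passes on the right first, so [x ord_max] is the left factor. *)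
Lemma standard_gbase_product (x : 'I_2 -> pi1 R X) : standard_gbase x ->
  (x ord_max * x ord0)%g = \pi_(pi1 R X) boundary_loop.
Proof.
case=> p [p_incr pK xE].
have pP i : p i = 1 \/ p i = -1.
  have /tangency_configP[] : config_set K (p i)%:C by rewrite -pK; exists i.
    by move=> [->]; left.
  by move=> [->]; right.
have lt01 : p ord0 < p ord_max by exact: p_incr.
have [p0 p1] : p ord0 = -1 /\ p ord_max = 1.
  by case: (pP ord0) lt01 => ->; case: (pP ord_max) => -> //; lra.
have [e1 [l1 [e10 e1K l1E ->]]] := xE ord0.
have [e2 [l2 [e20 e2K l2E ->]]] := xE ord_max.
have e12 := lasso_radius (pP ord0) e10 e1K; have e22 := lasso_radius (pP ord_max) e20 e2K.
rewrite p0 in l1E; rewrite p1 in l2E.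
rewrite [LHS](pi1_mulE l2 l1); apply/eq_pi1.
by apply: lasso_product_boundary l1E l2E; apply/andP.
Qed.

End BoundaryProduct.

(** * Group algebra of the relators *)

Section ConjugationRelators.
Context {G : groupType}.
Local Open Scope group_scope.
Implicit Types (N A : set G).

Lemma normal_closure_sub A N : normal_subgroup N -> A `<=` N -> normal_closure A `<=` N.
Proof. by move=> nN AN y; apply. Qed.

Lemma normal_closure_normal A : normal_subgroup (normal_closure A).
Proof.
split=> [N [[]]//|a b Aa Ab N|a Aa N|a g Aa N] hN; have [[N1 NM NV NJ] AN] := hN.
- by apply: NM; [exact: Aa|exact: Ab].
- by apply: NV; exact: Aa.
- by apply: NJ; exact: Aa.
Qed.

Lemma normal_closure_gen A a : A a -> normal_closure A a.
Proof. by move=> Aa N [_]; apply. Qed.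

(* With b = x2 x1, both relators of conjugation by b^-2 are commutators with  *)
(* b^2, and the one of x2 follows from that of x1 since x2 = b x1^-1.         *)
Lemma normal_closure_conj_product (x : 'I_2 -> G) :
  let x1 := x ord0 in let x2 := x ord_max in
  normal_closure
    [set relator (x j ^ ((x2 * x1) ^- 2)) (x j) | j in [set: 'I_2]] =
  normal_closure [set relator ((x1 * x2) ^+ 2) ((x2 * x1) ^+ 2)].
Proof.
move=> x1 x2; have [b bE] : exists b, b = x2 * x1 by exists (x2 * x1).
have x2E : x2 = b * x1^-1 by rewrite bE mulgK.
rewrite -bE; set r := relator ((x1 * x2) ^+ 2) _.
(* [x1 * x2] and [x2 * x1] are conjugate by [x1], so [r] becomes a commutator of [x1] with
   [b ^+ 2]. *)
have x12 : x1 * x2 = b ^ x1^-1 by rewrite /conjg invgK -x2E.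
have rE : r = x1 * b ^+ 2 * x1^-1 * b ^- 2.
  by rewrite /r /relator x12 -conjXg /conjg invgK !mulgA.
have r1 : relator (x1 ^ (b ^- 2)) x1 = r^-1.
  by rewrite rE /relator /conjg !invgM !invgK !mulgA.
have r2 : relator (x2 ^ (b ^- 2)) x2 = (r ^ x1) ^ b^-1.
  by rewrite rE /relator /conjg !invgK x2E (invgM b x1^-1) invgK !mulgA mulgVK.
apply/seteqP; split; apply: normal_closure_sub; try exact: normal_closure_normal.
- have [N1 NM NV NJ] := normal_closure_normal [set r].
  have Nr : normal_closure [set r] r by exact: normal_closure_gen.
  move=> _ [j _ <-].
  have [->|->] : j = ord0 \/ j = ord_max.
    by case: j => -[|[|//]] ?; [left|right]; apply/val_inj.
  + by rewrite r1; exact: NV.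
  + by rewrite r2; apply: (NJ); apply: (NJ).
- move=> _ ->; set A := [set _ | _ in _].
  have [N1 NM NV NJ] := normal_closure_normal A.
  by rewrite -[r]invgK -r1; apply: NV; apply: normal_closure_gen; exists ord0.
Qed.

End ConjugationRelators.

Theorem theorem3p1 (R : realType) :
  (exists! beta : braid (@tangency_config R),
     local_braid_monodromy (@tangency_curve R) beta) /\
  forall beta : braid (@tangency_config R),
    local_braid_monodromy (@tangency_curve R) beta ->
    induced_by_motion
      (rotation_motion (fun i : 'I_2 => (-1 : R[i]) ^+ i) (4 * pi)) beta /\
    forall x : 'I_2 -> pi1 R (punctured_disk (@tangency_config R)),
      standard_gbase x ->
      let x1 := x ord0 in
      let x2 := x ord_max in
      normal_closure (braid_relators beta x) =
      normal_closure [set relator ((x1 * x2) ^+ 2)%g ((x2 * x1) ^+ 2)%g].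
Proof.
have bmP := @tangency_braid_monodromy R.
split; first by exists (braid_class double_full_twist); split=> [|b /bmP //]; apply/bmP.
move=> _ /bmP ->; split; first exact: rotation_motion_double_full_twist.
move=> x gx x1 x2; rewrite -normal_closure_conj_product; congr normal_closure.
by apply/seteqP; split=> _ [j _ <-]; exists j => //;
  rewrite braid_autE double_full_twist_conj -(standard_gbase_product gx).
Qed.
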